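(* Fix an integer $N\ge1$ and let $S$ be a 2-string with $|S|=2N$. Then $$F_S(x_1,\dots,x_N;\bm{z})=\langle\langle 2^N\|\,\Gamma_{S_1}(z_1)\Gamma_{S_2}(z_2)\Gamma_{S_3}(z_3)\cdots\|0^N\rangle\rangle,$$ where $\langle\langle 2^N\|=\bigotimes_{i=1}^{N}(0\ 0\ 1)_i\in V_1^*\otimes\cdots\otimes V_N^*$ and $\|0^N\rangle\rangle=\bigotimes_{i=1}^{N}(1\ 0\ 0)^{T}_i\in V_1\otimes\cdots\otimes V_N$.
   Context: **Weights.** All parameters ($q$ and the spectral parameters) are generic/indeterminates. For $i,j,k,\ell\in\{0,1,2\}$ the Izergin--Korepin vertex weight $W_{y/x}(i,j;k,\ell)$ ($i$ = bottom incoming state, $j$ = left incoming state, $k$ = top outgoing state, $\ell$ = right outgoing state; $x$ = parameter of the horizontal line, $y$ = parameter of the vertical line) depends on $x,y$ only through $y/x$, and, with $D=(x-q^2y)(x-q^3y)$, is given by $W(0,0;0,0)=W(2,2;2,2)=1$; $W(1,0;1,0)=W(2,1;2,1)=\frac{q^2(x-y)}{x-q^2y}$; $W(1,0;0,1)=W(2,1;1,2)=\frac{(1-q^2)x}{x-q^2y}$; $W(0,1;1,0)=W(1,2;2,1)=\frac{(1-q^2)y}{x-q^2y}$; $W(0,1;0,1)=W(1,2;1,2)=\frac{x-y}{x-q^2y}$; $W(2,0;2,0)=\frac{q^4(x-y)(x-qy)}{D}$; $W(2,0;1,1)=-\frac{q(1-q)^2(1+q)x(x-y)}{D}$; $W(2,0;0,2)=\frac{(1-q^2)x(x+qx-qy-q^3y)}{D}$;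 $W(1,1;2,0)=-\frac{q^4(1+q)(x-y)y}{D}$; $W(1,1;1,1)=\frac{-qx^2+(1+q)(1-q^2+q^4)xy-q^4y^2}{D}$; $W(1,1;0,2)=\frac{(1+q)x(x-y)}{D}$; $W(0,2;2,0)=\frac{(1-q^2)(x+q^2x-q^2y-q^3y)y}{D}$; $W(0,2;1,1)=\frac{q(1-q)^2(1+q)(x-y)y}{D}$; $W(0,2;0,2)=\frac{(x-y)(x-qy)}{D}$; and $W=0$ in all other cases. **2-strings and $F_S$.** A 2-string is an infinite vector $S=(S_1,S_2,\dots)$ with $S_i\in\{0,1,2\}$ and only finitely many nonzero entries; $|S|=\sum_i S_i$. Let $|S|=2N$ and choose $L$ with $S_c=0$ for $c>L$. Then $$F_S(x_1,\dots,x_N;\bm{z})=\sum\prod_{r=1}^{N}\prod_{c=1}^{L}W_{z_c/x_r}(v_{r-1,c},h_{r,c-1};v_{r,c},h_{r,c}),$$ summed over all $h_{r,c}\in\{0,1,2\}$ ($1\le r\le N$, $0\le c\le L$) and $v_{r,c}\in\{0,1,2\}$ ($0\le r\le N$, $1\le c\le L$) with $h_{r,0}=2$, $h_{r,L}=0$, $v_{0,c}=0$, $v_{N,c}=S_c$. (Independent of $L$.) **Local matrices.** $V_i\cong\mathbb{C}^3$ with basis indexed by $0,1,2$ (rows and columns in this order); a subscript $i$ means the matrix acts on $V_i$ and as the identity on the other factors. $E_i^{a,b}$ is the elementary matrix with a 1 in row $a$, column $b$, acting on $V_i$. $d_i(z)=\mathrm{diag}\left(1,\frac{x_i-z}{x_i-q^2z},\frac{(x_i-z)(x_i-qz)}{(x_i-q^2z)(x_i-q^3z)}\right)_i$,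 $d_i^{\circ}(z)=\mathrm{diag}\left(1,\frac{(qx_i-z)(x_i-q^2z)}{(1+q)(x_i-z)},\frac{x_i-q^3z}{x_i-qz}\right)_i$, $d_i^{\bullet}(z)=\mathrm{diag}\left(1,\frac{1+q}{qx_i-z},\frac{x_i-q^2z}{x_i-z}\right)_i$, $d_i^{\bullet\circ}(z)=\mathrm{diag}\left(1,\frac{x_i-q^2z}{x_i-z},\frac{(x_i-q^2z)(x_i-q^3z)}{(x_i-z)(x_i-qz)}\right)_i$; $e_i^{\circ}(z)=\frac{(1-q^2)z}{x_i-q^2z}E_i^{1,0}$, $e_i^{\bullet}(z)=\frac{q(1-q)^2(1+q)(x_i-z)z}{(x_i-q^2z)(x_i-q^3z)}E_i^{2,1}$, $e_i^{\bullet\circ}(z)=\frac{(1-q^2)(x_i+q^2x_i-q^2z-q^3z)z}{(x_i-q^2z)(x_i-q^3z)}E_i^{2,0}$; and for $i\ne j$: $e_{ij}^{\circ\circ}(z)=\frac{x_ix_j+q^2x_ix_j-q^2x_iz-q^2x_jz}{(1-q^2)z}e_i^{\circ}(z)e_j^{\circ}(z)$, $e_{ij}^{\bullet\circ}(z)=e_{ji}^{\circ\bullet}(z)=\frac{x_ix_j+q^2x_ix_j-q^2x_iz-q^3x_jz}{q(1-q)(x_i-x_j)z}e_i^{\bullet}(z)e_j^{\circ}(z)$, $e_{ij}^{\bullet\bullet}(z)=\frac{(1+q)(x_ix_j+q^2x_ix_j-q^3x_iz-q^3x_jz)}{q(1-q)(x_i-qx_j)(x_j-qx_i)z}e_i^{\bullet}(z)e_j^{\bullet}(z)$.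 **Twisted column operators** on $V_1\otimes\cdots\otimes V_N$: $$\Gamma_0(z)=\prod_{i=1}^{N}d_i(z),\qquad \Gamma_1(z)=\sum_{u\in\{\circ,\bullet\}}\sum_{i=1}^{N}e_i^{u}(z)\prod_{j\ne i}d_j(z)d_j^{u}(x_i),$$ $$\Gamma_2(z)=\sum_{i=1}^{N}e_i^{\bullet\circ}(z)\prod_{j\ne i}d_j(z)d_j^{\bullet\circ}(x_i)+\sum_{u,v\in\{\circ,\bullet\}}\ \sum_{1\le i<j\le N}e_{ij}^{uv}(z)\prod_{k\ne i,j}d_k(z)d_k^{u}(x_i)d_k^{v}(x_j).$$ The infinite product in the claim is ordered left to right by increasing index; since $\Gamma_0(z)\|0^N\rangle\rangle=\|0^N\rangle\rangle$, it is understood as truncated after any $L$ with $S_c=0$ for $c>L$. *)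

(* Defs.v *)
From mathcomp Require Import all_boot all_order all_algebra.

Set Implicit Arguments.
Unset Strict Implicit.
Unset Printing Implicit Defensive.

Import GRing.Theory.
Local Open Scope ring_scope.

(* Weight W_{y/x}(i, j; k, l) of the vertex with bottom state i, left state j,
   top state k, right state l; x is the parameter of the horizontal line and
   y that of the vertical line. *)
Definition ikW (F : fieldType) (q x y : F) (i j k l : nat) : F :=
  let D := (x - q ^+ 2 * y) * (x - q ^+ 3 * y) in
  match (i, j, k, l) with
  | (0, 0, 0, 0)%N | (2, 2, 2, 2)%N => 1
  | (1, 0, 1, 0)%N | (2, 1, 2, 1)%N => q ^+ 2 * (x - y) / (x - q ^+ 2 * y)
  | (1, 0, 0, 1)%N | (2, 1, 1, 2)%N => (1 - q ^+ 2) * x / (x - q ^+ 2 * y)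
  | (0, 1, 1, 0)%N | (1, 2, 2, 1)%N => (1 - q ^+ 2) * y / (x - q ^+ 2 * y)
  | (0, 1, 0, 1)%N | (1, 2, 1, 2)%N => (x - y) / (x - q ^+ 2 * y)
  | (2, 0, 2, 0)%N => q ^+ 4 * (x - y) * (x - q * y) / D
  | (2, 0, 1, 1)%N => - (q * (1 - q) ^+ 2 * (1 + q) * x * (x - y) / D)
  | (2, 0, 0, 2)%N =>
      (1 - q ^+ 2) * x * (x + q * x - q * y - q ^+ 3 * y) / D
  | (1, 1, 2, 0)%N => - (q ^+ 4 * (1 + q) * (x - y) * y / D)
  | (1, 1, 1, 1)%N =>
      (- (q * x ^+ 2) + (1 + q) * (1 - q ^+ 2 + q ^+ 4) * x * y
       - q ^+ 4 * y ^+ 2) / D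
  | (1, 1, 0, 2)%N => (1 + q) * x * (x - y) / D
  | (0, 2, 2, 0)%N =>
      (1 - q ^+ 2) * (x + q ^+ 2 * x - q ^+ 2 * y - q ^+ 3 * y) * y / D
  | (0, 2, 1, 1)%N => q * (1 - q) ^+ 2 * (1 + q) * (x - y) * y / D
  | (0, 2, 0, 2)%N => (x - y) * (x - q * y) / D
  | _ => 0
  end.

(* Columns are numbered from 0: S c and z c stand for S_{c+1} and z_{c+1}, so
   that S : nat -> 'I_3 with [string_below S L] for some L is a 2-string. *)
Definition string_below (S : nat -> 'I_3) (L : nat) : Prop :=
  forall c : nat, (L <= c)%N -> S c = 0.

(* Row r : 'I_N is the (r+1)-st row: its vertex in column c has bottom edge
   v r c, top edge v r.+1 c, left edge h r c and right edge h r c.+1. *)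
Definition F_S (F : fieldType) (N L : nat) (q : F) (S : nat -> 'I_3)
    (x : 'I_N -> F) (z : nat -> F) : F :=
  \sum_(h : 'M['I_3]_(N, L.+1)
          | [forall r, (h r ord0 == 2) && (h r ord_max == 0)])
  \sum_(v : 'M['I_3]_(N.+1, L)
          | [forall c, (v ord0 c == 0) && (v ord_max c == S c)])
  \prod_(r < N) \prod_(c < L)
     ikW q (x r) (z c)
       (v (widen_ord (leqnSn N) r) c) (h r (widen_ord (leqnSn L) c))
       (v (lift ord0 r) c) (h r (lift ord0 c)).

(* The standard basis of V_1 (x) ... (x) V_N, with V_i = F^3, is indexed by
   [state N]; matrices use its enumeration. *)
Notation state N := {ffun 'I_N -> 'I_3}.
Notation tensor_op F N := 'M[F]_#|{: state N}|.

Section LocalOperators.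

Variables (F : fieldType) (N : nat).

Definition state_at (a : 'I_#|{: state N}|) : state N := enum_val a.

Definition local_op (i : 'I_N) (A : 'M[F]_3) : tensor_op F N :=
  \matrix_(a, b)
    (if [forall j, (j != i) ==> (state_at a j == state_at b j)]
     then A (state_at a i) (state_at b i) else 0).

Definition tensor_row (u : 'I_N -> 'rV[F]_3) : 'rV[F]_#|{: state N}| :=
  \row_a \prod_i u i 0 (state_at a i).

Definition tensor_col (u : 'I_N -> 'cV[F]_3) : 'cV[F]_#|{: state N}| :=
  \col_a \prod_i u i (state_at a i) 0.

Definition diag3 (a b c : F) : 'M[F]_3 :=
  diag_mx (\row_(j < 3) [:: a; b; c]`_j).

End LocalOperators.

(* Superscripts: w is the white dot, b the black dot. *)
Section ColumnOperators.

Variables (F : fieldType) (N : nat) (q : F) (x : 'I_N -> F).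

Definition d_ (i : 'I_N) (z : F) : tensor_op F N :=
  local_op i (diag3 1
    ((x i - z) / (x i - q ^+ 2 * z))
    ((x i - z) * (x i - q * z) / ((x i - q ^+ 2 * z) * (x i - q ^+ 3 * z)))).

Definition d_w (i : 'I_N) (z : F) : tensor_op F N :=
  local_op i (diag3 1
    ((q * x i - z) * (x i - q ^+ 2 * z) / ((1 + q) * (x i - z)))
    ((x i - q ^+ 3 * z) / (x i - q * z))).

Definition d_b (i : 'I_N) (z : F) : tensor_op F N :=
  local_op i (diag3 1
    ((1 + q) / (q * x i - z))
    ((x i - q ^+ 2 * z) / (x i - z))).

Definition d_bw (i : 'I_N) (z : F) : tensor_op F N :=
  local_op i (diag3 1
    ((x i - q ^+ 2 * z) / (x i - z))
    ((x i - q ^+ 2 * z) * (x i - q ^+ 3 * z) / ((x i - z) * (x i - q * z)))).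

Definition e_w (i : 'I_N) (z : F) : tensor_op F N :=
  ((1 - q ^+ 2) * z / (x i - q ^+ 2 * z)) *: local_op i (delta_mx 1 0).

Definition e_b (i : 'I_N) (z : F) : tensor_op F N :=
  (q * (1 - q) ^+ 2 * (1 + q) * (x i - z) * z
     / ((x i - q ^+ 2 * z) * (x i - q ^+ 3 * z)))
    *: local_op i (delta_mx 2 1).

Definition e_bw (i : 'I_N) (z : F) : tensor_op F N :=
  ((1 - q ^+ 2) * (x i + q ^+ 2 * x i - q ^+ 2 * z - q ^+ 3 * z) * z
     / ((x i - q ^+ 2 * z) * (x i - q ^+ 3 * z)))
    *: local_op i (delta_mx 2 0).

Definition e_w_w (i j : 'I_N) (z : F) : tensor_op F N :=
  ((x i * x j + q ^+ 2 * x i * x j - q ^+ 2 * x i * z - q ^+ 2 * x j * z)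
     / ((1 - q ^+ 2) * z))
    *: (e_w i z * e_w j z).

Definition e_b_w (i j : 'I_N) (z : F) : tensor_op F N :=
  ((x i * x j + q ^+ 2 * x i * x j - q ^+ 2 * x i * z - q ^+ 3 * x j * z)
     / (q * (1 - q) * (x i - x j) * z))
    *: (e_b i z * e_w j z).

Definition e_w_b (i j : 'I_N) (z : F) : tensor_op F N := e_b_w j i z.

Definition e_b_b (i j : 'I_N) (z : F) : tensor_op F N :=
  ((1 + q)
     * (x i * x j + q ^+ 2 * x i * x j - q ^+ 3 * x i * z - q ^+ 3 * x j * z)
     / (q * (1 - q) * (x i - q * x j) * (x j - q * x i) * z))
    *: (e_b i z * e_b j z).

(* Sums over the two colours are sums over bool: false is white, true black. *)
Definition d_dot (u : bool) := if u then d_b else d_w.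
Definition e_dot (u : bool) := if u then e_b else e_w.
Definition e_dot2 (u v : bool) :=
  match u, v with
  | false, false => e_w_w
  | true, false => e_b_w
  | false, true => e_w_b
  | true, true => e_b_b
  end.

Definition Gamma0 (z : F) : tensor_op F N := \prod_(i < N) d_ i z.

Definition Gamma1 (z : F) : tensor_op F N :=
  \sum_(u : bool) \sum_(i < N)
    e_dot u i z * \prod_(j < N | j != i) (d_ j z * d_dot u j (x i)).

Definition Gamma2 (z : F) : tensor_op F N :=
  \sum_(i < N) e_bw i z * \prod_(j < N | j != i) (d_ j z * d_bw j (x i))
  + \sum_(u : bool) \sum_(v : bool) \sum_(i < N) \sum_(j < N | (i < j)%N)
      e_dot2 u v i j z *
      \prod_(k < N | (k != i) && (k != j))
        (d_ k z * d_dot u k (x i) * d_dot v k (x j)).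

Definition Gamma (k : 'I_3) : F -> tensor_op F N :=
  match val k with
  | 0%N => Gamma0
  | 1%N => Gamma1
  | _ => Gamma2
  end.

(* Genericity of the parameters: every quantity occurring as a denominator in
   the weights and in the operators is nonzero. *)
Definition generic (z : nat -> F) : Prop :=
  [/\ [/\ q != 0, 1 - q != 0 & 1 + q != 0],
      forall c, z c != 0,
      forall i c, (x i - q ^+ 2 * z c != 0) /\ (x i - q ^+ 3 * z c != 0) &
      forall i j, i != j -> (x i - x j != 0) /\ (x i - q * x j != 0)].

Definition bra_2N : 'rV[F]_#|{: state N}| :=
  tensor_row (fun=> delta_mx 0 2).

Definition ket_0N : 'cV[F]_#|{: state N}| :=
  tensor_col (fun=> delta_mx 0 0).

End ColumnOperators.

Arguments bra_2N F N : clear implicits.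
Arguments ket_0N F N : clear implicits.

(* Main.v *)
Require Import Defs.
From mathcomp Require Import all_boot all_order all_algebra.
From mathcomp Require Import ring.
Set Implicit Arguments.
Unset Strict Implicit.
Unset Printing Implicit Defensive.
Import GRing.Theory.
Local Open Scope ring_scope.

(* Reading the lattice column by column, F_S is the matrix element
   <2^N| C_{S_1}(z_1) ... C_{S_L}(z_L) |0^N> of a product of untwisted column
   operators C_k(z), which satisfy quadratic exchange relations by the
   Yang-Baxter equation. One builds, by induction on N, an invertible operator T
   of weight zero with T C_k(z) = Gamma_k(z) T that fixes <2^N| and |0^N>, so that
   it drops out of the matrix element. For one more site with parameter w,
   T_{N+1} = P (T_N (x) 1), where P is a 3x3 block upper triangular matrix over
   the new site with first row (Gamma_0(w), Gamma_1(w), Gamma_2(w)): its first row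
   intertwines because of the exchange relations, the other two rows because of
   identities in which at most two sites change state, when k = 0, 1. The case
   k = 2 then follows from uniqueness: the exchange relations determine the
   commutator of T C_2(z) T^-1 with Gamma_0(v) for all v, the diagonal operators
   Gamma_0(v) have simple joint spectrum, and the diagonal part vanishes for
   weight reasons. Invertibility of P needs more genericity than is assumed; it
   holds over F(t) for the parameters x_i + t^i, i >= 1, and the identity is then
   specialized at t = 0. *)

(** * Tensor product operators *)

Section ThreeStates.
Variable F : fieldType.

Lemma ord3P (i : 'I_3) : [\/ i = 0, i = 1 | i = 2].
Proof.
by case: i => [[|[|[|i]]] Hi] //; [apply: Or31|apply: Or32|apply: Or33];
  apply: val_inj.
Qed.

Lemma big_ord3 (V : zmodType) (f : 'I_3 -> V) :
  \sum_(i < 3) f i = f 0 + f 1 + f 2.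
Proof.
rewrite !big_ord_recl big_ord0 addr0 addrA.
by congr (f _ + f _ + f _); apply: val_inj.
Qed.

Lemma one_sub_sqr_neq0 (q : F) : 1 - q != 0 -> 1 + q != 0 -> 1 - q ^+ 2 != 0.
Proof.
move=> q1 q2; have -> : 1 - q ^+ 2 = (1 - q) * (1 + q) by ring.
by rewrite mulf_neq0.
Qed.

Definition tri (a b c : F) (j : 'I_3) : F := [:: a; b; c]`_j.

Definition dgm (f : 'I_3 -> F) : 'M[F]_3 := diag_mx (\row_j f j).

Lemma dgmE f (a b : 'I_3) : dgm f a b = f a *+ (a == b :> 'I_3).
Proof. by rewrite !mxE; case: eqP => // ->. Qed.

Lemma dgm_mul f g : dgm f *m dgm g = dgm (fun a => f a * g a).
Proof.
apply/matrixP => a b; rewrite mul_diag_mx !mxE; case: eqP => [->|_];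
  by rewrite ?mulr1n ?mulr0n ?mulr0.
Qed.

Lemma dgm_delta f a b :
  dgm f *m (delta_mx a b : 'M_3) = f a *: (delta_mx a b : 'M_3).
Proof.
apply/matrixP => c d; rewrite mul_diag_mx !mxE.
by case: eqP => [->|_] //=; rewrite !mulr0.
Qed.

Lemma delta_dgm f a b :
  (delta_mx a b : 'M_3) *m dgm f = f b *: (delta_mx a b : 'M_3).
Proof.
apply/matrixP => c d; rewrite mul_mx_diag !mxE mulrC.
by case: (d =P b) => [->|_] //=; rewrite andbF !mulr0.
Qed.

End ThreeStates.

Section TensorOperators.
Variables (F : fieldType) (N : nat).
Notation op := (tensor_op F N).
Implicit Types (A B : op) (s t : state N).

(** Entries are indexed by states, which keeps the enumeration behind the matrix indices out of all
    computations. *)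
Definition ent A s t : F := A (enum_rank s) (enum_rank t).

Definition mkop (f : state N -> state N -> F) : op :=
  \matrix_(a, b) f (enum_val a) (enum_val b).

Lemma mkopE f s t : ent (mkop f) s t = f s t.
Proof. by rewrite /ent mxE !enum_rankK. Qed.

Lemma opP A B : (forall s t, ent A s t = ent B s t) -> A = B.
Proof.
move=> AB; apply/matrixP => a b.
by have := AB (enum_val a) (enum_val b); rewrite /ent !enum_valK.
Qed.

Lemma reindex_rank (g : 'I_#|{: state N}| -> F) :
  \sum_a g a = \sum_(s : state N) g (enum_rank s).
Proof. by rewrite (reindex enum_rank) //; apply/onW_bij/enum_rank_bij. Qed.

Lemma entM A B s t : ent (A * B) s t = \sum_u ent A s u * ent B u t.
Proof. by rewrite /ent -mulmxE mxE reindex_rank. Qed.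

Lemma entD A B s t : ent (A + B) s t = ent A s t + ent B s t.
Proof. by rewrite /ent mxE. Qed.

Lemma entZ c A s t : ent (c *: A) s t = c * ent A s t.
Proof. by rewrite /ent mxE. Qed.

Lemma ent0 s t : ent 0 s t = 0.
Proof. by rewrite /ent mxE. Qed.

Lemma ent1 s t : ent 1 s t = (s == t)%:R.
Proof. by rewrite /ent mxE (inj_eq enum_rank_inj). Qed.

Lemma ent_sum I (r : seq I) (P : pred I) (f : I -> op) s t :
  ent (\sum_(i <- r | P i) f i) s t = \sum_(i <- r | P i) ent (f i) s t.
Proof. by rewrite /ent summxE. Qed.

Lemma opZMl c A B : (c *: A) * B = c *: (A * B).
Proof. by rewrite -!mulmxE scalemxAl. Qed.

Lemma opZMr c A B : A * (c *: B) = c *: (A * B).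
Proof. by rewrite -!mulmxE scalemxAr. Qed.

(** The pure tensor of the matrices [M i]. The twisted column operators are linear combinations of
    pure tensors, which multiply site by site. *)
Definition prodop (M : 'I_N -> 'M[F]_3) : op :=
  mkop (fun s t => \prod_i M i (s i) (t i)).

Lemma prodopM M M' : prodop M * prodop M' = prodop (fun i => M i *m M' i).
Proof.
apply: opP => s t; rewrite entM mkopE.
under [RHS]eq_bigr do rewrite mxE.
rewrite bigA_distr_bigA; apply: eq_bigr => u _.
by rewrite !mkopE -big_split.
Qed.

Lemma eq_prodop M M' : M =1 M' -> prodop M = prodop M'.
Proof.
by move=> MM'; apply: opP => s t; rewrite !mkopE; apply: eq_bigr => i _; rewrite MM'.
Qed.

Lemma prodop1 : prodop (fun=> 1%:M) = 1.
Proof.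
apply: opP => s t; rewrite mkopE ent1; case: eqP => [->|ne_st].
  by apply: big1 => i _; rewrite mxE eqxx.
have /existsP[i ne_i] : [exists i, s i != t i].
  rewrite -negb_forall; apply/forallP => st; apply: ne_st.
  by apply/ffunP => i; apply/eqP.
by rewrite (bigD1 i) //= mxE (negbTE ne_i) mul0r.
Qed.

Lemma prodopZ1 i c M M' : M i = c *: M' i ->
  (forall j, j != i -> M j = M' j) -> prodop M = c *: prodop M'.
Proof.
move=> Mi Mj; apply: opP => s t; rewrite entZ !mkopE.
rewrite (bigD1 i) //= [X in _ = _ * X](bigD1 i) //= Mi mxE -mulrA.
by congr (_ * (_ * _)); apply: eq_bigr => j ne_ji; rewrite Mj.
Qed.

Lemma prodopZ2 i j c d M M' : i != j -> M i = c *: M' i -> M j = d *: M' j ->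
  (forall k, k != i -> k != j -> M k = M' k) -> prodop M = (c * d) *: prodop M'.
Proof.
move=> ne_ij Mi Mj Mk.
rewrite -scalerA.
pose M1 k := if k == j then M j else M' k.
rewrite (@prodopZ1 i c M M1) /M1 ?(negbTE ne_ij) //; last first.
  by move=> k ne_ki; case: eqP => [->//|/eqP ne_kj]; apply: Mk.
by congr (_ *: _); apply: (@prodopZ1 j); rewrite ?eqxx // => k /negbTE->.
Qed.

Lemma local_opE i M : local_op i M = prodop (fun j => if j == i then M else 1%:M).
Proof.
apply: opP => s t; rewrite /ent mxE /state_at !enum_rankK -/(ent _ _ _) mkopE.
rewrite (bigD1 i) //= eqxx; case: ifP => [/forallP st|/forallP st].
  rewrite big1 ?mulr1 // => j ne_ji; rewrite (negbTE ne_ji) mxE.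
  by have := st j; rewrite ne_ji /= => ->.
have /existsP[j] : [exists j, ~~ ((j != i) ==> (s j == t j))].
  by rewrite -negb_forall; apply/negP => /forallP.
rewrite negb_imply => /andP[ne_ji ne_st].
by rewrite (bigD1 j) //= (negbTE ne_ji) mxE (negbTE ne_st) mul0r mulr0.
Qed.

(** Each factor acts on its own site only, so the ordered product collapses to a single pure
    tensor. *)
Lemma prod_prodop (P : pred 'I_N) (M : 'I_N -> 'I_N -> 'M[F]_3) :
    (forall i j, P i -> j != i -> M i j = 1%:M) ->
  \prod_(i | P i) prodop (M i) = prodop (fun j => if P j then M j j else 1%:M).
Proof.
move=> M1.
suff gen (r : seq 'I_N) : uniq r ->
    \prod_(i <- r | P i) prodop (M i)
    = prodop (fun j => if (j \in r) && P j then M j j else 1%:M).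
  rewrite gen ?index_enum_uniq //; apply: eq_prodop => j.
  by rewrite mem_index_enum.
elim: r => [_|i r IH /= /andP[i_r uniq_r]].
  by rewrite big_nil -prodop1; apply: eq_prodop.
rewrite big_cons; case: ifP => Pi; rewrite IH //; last first.
  apply: eq_prodop => j; rewrite in_cons; case: eqP => [->|_] //=.
  by rewrite Pi andbF.
rewrite prodopM; apply: eq_prodop => j; rewrite in_cons; case: eqP => [->|/eqP ne_ji] /=.
  by rewrite (negbTE i_r) Pi mulmx1.
by rewrite M1 // mul1mx.
Qed.

End TensorOperators.

(** * The Yang-Baxter equation and the column operators *)

Section YangBaxter.
Variables (F : fieldType) (q : F).

Lemma ikW_conserve x y i j k l : (i + j != k + l)%N -> ikW q x y i j k l = 0.
Proof.
rewrite /ikW.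
by case: i => [|[|[|i]]]; case: j => [|[|[|j]]]; case: k => [|[|[|k]]] //;
  case: l => [|[|[|l]]].
Qed.

(** Written out so that [cbv] can evaluate the weights at numerals. *)
Let sum3 (f : nat -> F) := f 0%N + f 1%N + f 2%N.

(** The weights compute only at concrete states. For each conserving choice of the six outer states
    the equation is an identity of rational functions. *)
Lemma yang_baxter_nat x v z m n h k b l :
    x - q ^+ 2 * z != 0 -> x - q ^+ 3 * z != 0 ->
    x - q ^+ 2 * v != 0 -> x - q ^+ 3 * v != 0 ->
    v - q ^+ 2 * z != 0 -> v - q ^+ 3 * z != 0 ->
    (m < 3)%N -> (n < 3)%N -> (h < 3)%N -> (k < 3)%N -> (b < 3)%N -> (l < 3)%N ->
    (m + n + h = k + b + l)%N ->
  sum3 (fun j => sum3 (fun j' => sum3 (fun h' =>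
    ikW q v z m n j j' * (ikW q x z j h k h' * ikW q x v j' h' b l)))) =
  sum3 (fun n' => sum3 (fun m' => sum3 (fun h' =>
    ikW q x v n h n' h' * ikW q x z m h' m' l * ikW q v z m' n' k b))).
Proof.
move=> xz2 xz3 xv2 xv3 vz2 vz3.
case: m => [|[|[|m]]] // _; case: n => [|[|[|n]]] // _; case: h => [|[|[|h]]] // _;
case: k => [|[|[|k]]] // _; case: b => [|[|[|b]]] // _; case: l => [|[|[|l]]] // _ E;
  (discriminate E || clear E); cbv [sum3 ikW];
  (field; by rewrite ?xz2 ?xz3 ?xv2 ?xv3 ?vz2 ?vz3).
Qed.

Lemma yang_baxter x v z (m n h k b l : 'I_3) :
    x - q ^+ 2 * z != 0 -> x - q ^+ 3 * z != 0 ->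
    x - q ^+ 2 * v != 0 -> x - q ^+ 3 * v != 0 ->
    v - q ^+ 2 * z != 0 -> v - q ^+ 3 * z != 0 ->
  \sum_(j < 3) \sum_(j' < 3) \sum_(h' < 3)
    ikW q v z m n j j' * (ikW q x z j h k h' * ikW q x v j' h' b l) =
  \sum_(n' < 3) \sum_(m' < 3) \sum_(h' < 3)
    ikW q x v n h n' h' * ikW q x z m h' m' l * ikW q v z m' n' k b.
Proof.
move=> xz2 xz3 xv2 xv3 vz2 vz3.
(* If the outer states violate conservation, every term on either side contains a vertex that does,
   so both sides vanish. *)
have [E|NE] := eqVneq (m + n + h)%N (k + b + l)%N; last first.
  rewrite !big1 // => i _; rewrite big1 // => j _; rewrite big1 // => a _.
    have [E1|/ikW_conserve->] := eqVneq (n + h)%N (i + a)%N; last by rewrite !mul0r.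
    have [E2|/ikW_conserve->] := eqVneq (m + a)%N (j + l)%N; last by rewrite mulr0 mul0r.
    rewrite [X in _ * X]ikW_conserve ?mulr0 //.
    by apply: contra NE => /eqP E3; rewrite -addnA E1 addnCA E2 addnA (addnC i) E3.
  have [E1|/ikW_conserve->] := eqVneq (m + n)%N (i + j)%N; last by rewrite !mul0r.
  have [E2|/ikW_conserve->] := eqVneq (i + h)%N (k + a)%N; last by rewrite mul0r mulr0.
  rewrite [ikW q x v _ _ _ _]ikW_conserve ?mulr0 //.
  by apply: contra NE => /eqP E3; rewrite E1 addnAC E2 -addnA (addnC a) E3 addnA.
have := yang_baxter_nat xz2 xz3 xv2 xv3 vz2 vz3
  (ltn_ord m) (ltn_ord n) (ltn_ord h) (ltn_ord k) (ltn_ord b) (ltn_ord l) E.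
have sum3E f : sum3 f = \sum_(j < 3) f j.
  by rewrite /sum3 !big_ord_recl big_ord0 addr0 addrA.
rewrite !sum3E => E'; symmetry.
under eq_bigr => i _ do under eq_bigr => j _ do rewrite -(sum3E (fun h' : nat =>
  ikW q x v n h i h' * ikW q x z m h' j l * ikW q v z j i k b)).
under eq_bigr => i _ do rewrite -(sum3E (fun j : nat => sum3 (fun h' : nat =>
  ikW q x v n h i h' * ikW q x z m h' j l * ikW q v z j i k b))).
rewrite -E'; apply: eq_bigr => i _; rewrite sum3E.
by apply: eq_bigr => j _; rewrite sum3E.
Qed.
End YangBaxter.

(** * Splitting off the last site *)

Section AppendSite.
Variables (T : finType) (N : nat).

Definition wid (i : 'I_N) : 'I_N.+1 := widen_ord (leqnSn N) i.

Lemma wid_max i : wid i != ord_max.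
Proof. by rewrite -val_eqE /= neq_ltn ltn_ord. Qed.

Lemma wid_inj : injective wid.
Proof. by move=> i j /(congr1 val) /= ij; apply: val_inj. Qed.

Lemma widP (i : 'I_N.+1) : i = ord_max \/ exists j, i = wid j.
Proof.
have [lt_iN|ge_iN] := ltnP i N.
  by right; exists (Ordinal lt_iN); apply: val_inj.
by left; apply: val_inj; apply/eqP; rewrite eqn_leq ge_iN -ltnS ltn_ord.
Qed.

Definition sinit (s : {ffun 'I_N.+1 -> T}) : {ffun 'I_N -> T} := [ffun i => s (wid i)].

Definition sjoin (s : {ffun 'I_N -> T}) (a : T) : {ffun 'I_N.+1 -> T} :=
  [ffun i => if unlift ord_max i is Some j then s j else a].

Lemma wid_lift i : wid i = lift ord_max i.
Proof. by apply: val_inj; rewrite /= /bump leqNgt ltn_ord. Qed.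

Lemma sjoin_init s a : sinit (sjoin s a) = s.
Proof. by apply/ffunP => i; rewrite !ffunE wid_lift liftK. Qed.

Lemma sjoin_last s a : sjoin s a ord_max = a.
Proof. by rewrite ffunE unlift_none. Qed.

Lemma sjoinK s : sjoin (sinit s) (s ord_max) = s.
Proof.
apply/ffunP => i; have [->|[j ->]] := widP i; first by rewrite sjoin_last.
by rewrite ffunE wid_lift liftK ffunE wid_lift.
Qed.

Lemma state_eqE (s t : {ffun 'I_N.+1 -> T}) :
  (s == t) = (sinit s == sinit t) && (s ord_max == t ord_max).
Proof.
apply/eqP/andP => [->|[/eqP st /eqP stm]]; first by rewrite !eqxx.
by rewrite -(sjoinK s) -(sjoinK t) st stm.
Qed.

Lemma sum_state (V : nmodType) (f : {ffun 'I_N.+1 -> T} -> V) :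
  \sum_s f s = \sum_a \sum_s f (sjoin s a).
Proof.
rewrite pair_big /=.
rewrite (reindex (fun p : T * {ffun 'I_N -> T} => sjoin p.2 p.1)) //=.
exists (fun s : {ffun 'I_N.+1 -> T} => (s ord_max, sinit s)) => [[a s] _|s _] /=.
  by rewrite sjoin_last sjoin_init.
exact: sjoinK.
Qed.

End AppendSite.

Section Blocks.
Variables (F : fieldType) (N : nat).
Notation op := (tensor_op F N).

(** An operator on [N.+1] sites as a 3 by 3 matrix over the last site, with entries acting on the
    first [N] sites. *)
Definition blk (X : 'I_3 -> 'I_3 -> op) : tensor_op F N.+1 :=
  mkop (fun s t => ent (X (s ord_max) (t ord_max)) (sinit s) (sinit t)).

Lemma eq_blk X Y : (forall a b, X a b = Y a b) -> blk X = blk Y.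
Proof. by move=> XY; apply: opP => s t; rewrite !mkopE XY. Qed.

Lemma blkM X Y : blk X * blk Y = blk (fun a b => \sum_(c < 3) X a c * Y c b).
Proof.
apply: opP => s t; rewrite entM mkopE sum_state ent_sum; apply: eq_bigr => c _.
rewrite entM; apply: eq_bigr => u _.
by rewrite !mkopE sjoin_last sjoin_init.
Qed.

Lemma blkD X Y : blk X + blk Y = blk (fun a b => X a b + Y a b).
Proof. by apply: opP => s t; rewrite entD !mkopE entD. Qed.

Lemma blkZ c X : c *: blk X = blk (fun a b => c *: X a b).
Proof. by apply: opP => s t; rewrite entZ !mkopE entZ. Qed.

Lemma blk1 : blk (fun a b => (a == b)%:R) = 1.
Proof.
apply: opP => s t; rewrite mkopE ent1 state_eqE.
by case: eqP => _; rewrite ?andbF ?andbT ?ent0 ?ent1.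
Qed.

Lemma blk_sum I (r : seq I) (P : pred I) (X : I -> 'I_3 -> 'I_3 -> op) :
  \sum_(i <- r | P i) blk (X i) = blk (fun a b => \sum_(i <- r | P i) X i a b).
Proof.
apply: opP => s t; rewrite ent_sum mkopE ent_sum; apply: eq_bigr => i _.
by rewrite mkopE.
Qed.

Lemma prodop_blk (M : 'I_N.+1 -> 'M[F]_3) :
  prodop M = blk (fun a b => M ord_max a b *: prodop (fun i => M (wid i))).
Proof.
apply: opP => s t; rewrite !mkopE entZ mkopE big_ord_recr /= mulrC.
by congr (_ * _); apply: eq_bigr => i _; rewrite !ffunE.
Qed.

End Blocks.

Lemma exchange_big22 (V : zmodType) (n : nat) (f : 'I_n -> 'I_n -> 'I_n -> 'I_n -> V) :
  \sum_i \sum_j \sum_k \sum_l f i j k l = \sum_k \sum_l \sum_i \sum_j f i j k l.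
Proof.
transitivity (\sum_(p : 'I_n * 'I_n) \sum_(r : 'I_n * 'I_n) f p.1 p.2 r.1 r.2).
  by rewrite pair_big; apply: eq_bigr => p _; rewrite pair_big.
rewrite exchange_big [RHS]pair_big; apply: eq_bigr => r _.
by rewrite [RHS]pair_big.
Qed.

Section ColumnOperator.
Variables (F : fieldType) (q : F).

Definition vmat (x z : F) (h h' : 'I_3) : 'M[F]_3 :=
  \matrix_(a, b) ikW q x z a h b h'.

(** Here [s] and [t] are the states on the left and right edges of the column. The matrix product,
    bottom row first, sums over the inner vertical edges; the bottom edge is 0 and the top edge
    [k]. *)
Definition colop N (x : 'I_N -> F) (k : 'I_3) (z : F) : tensor_op F N :=
  mkop (fun s t => (\prod_(r < N) vmat (x r) z (s r) (t r)) 0 k).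

(** The top row is split off; [j] is the state on the vertical edge just below it. *)
Lemma colop_blk N (x : 'I_N.+1 -> F) k z :
  colop x k z = blk (fun h h' => \sum_(j < 3)
     ikW q (x ord_max) z j h k h' *: colop (fun i => x (wid i)) j z).
Proof.
apply: opP => s t; rewrite !mkopE ent_sum big_ord_recr /= -mulmxE mxE.
apply: eq_bigr => j _; rewrite entZ mkopE mulrC [X in X * _]mxE.
under [in RHS]eq_bigr do rewrite !ffunE.
by [].
Qed.

Definition admissible N (x : 'I_N -> F) (z : F) :=
  [/\ z != 0 & forall i, (x i - q ^+ 2 * z != 0) /\ (x i - q ^+ 3 * z != 0)].

(** The vertex at which the two column lines cross is pulled through both columns, with one use of
    the Yang-Baxter equation per row. Below all rows both of its incoming states are 0, so it forces
    its outgoing states to be 0 and has weight 1. *)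
Lemma colop_exchange N (x : 'I_N -> F) k b z v :
    admissible x z -> admissible x v ->
    v - q ^+ 2 * z != 0 -> v - q ^+ 3 * z != 0 ->
  colop x k z * colop x b v =
  \sum_(b' < 3) \sum_(j < 3) ikW q v z j b' k b *: (colop x b' v * colop x j z).
Proof.
move=> + + vz2 vz3; elim: N x k b => [|N IH] x k b [z0 xz] [v0 xv].
  have colop0 j y : colop x j y = (j == 0)%:R%:M.
    apply: opP => s t; rewrite mkopE big_ord0 /ent !mxE (inj_eq enum_rank_inj).
    have ->: s = t by apply/ffunP => -[].
    by rewrite eqxx mulr1n eq_sym.
  rewrite (bigD1 0) //= [X in _ + X]big1 ?addr0 => [|b' /negbTE b'0]; last first.
    by rewrite big1 // => j _; rewrite !colop0 b'0 -scalemx1 scale0r mul0r scaler0.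
  rewrite (bigD1 0) //= [X in _ + X]big1 ?addr0 => [|j /negbTE j0]; last first.
    by rewrite !colop0 j0 -[X in _ * X]scalemx1 scale0r mulr0 scaler0.
  rewrite !colop0 /= -!mulmxE -!scalar_mxM scale_scalar_mx !mulr1; congr (_%:M).
  by have [->|->|->] := ord3P k; have [->|->|->] := ord3P b;
    rewrite /ikW /= ?(mulr0, mul0r, mulr1).
set y := fun i => x (wid i).
have [yz yv]: admissible y z /\ admissible y v.
  by split; split=> // i; [apply: xz|apply: xv].
have {}IH := IH y _ _ yz yv.
under [RHS]eq_bigr do under eq_bigr do rewrite !colop_blk blkM blkZ.
under [RHS]eq_bigr do rewrite blk_sum.
rewrite !colop_blk blkM blk_sum -/y; apply: eq_blk => h l.
pose CC n m := colop y n v * colop y m z.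
have prodE (f g : 'I_3 -> 'I_3 -> F) (X Y : 'I_3 -> tensor_op F N) :
    \sum_(c < 3) (\sum_(i < 3) f i c *: X i) * (\sum_(j < 3) g j c *: Y j)
    = \sum_(i < 3) \sum_(j < 3) (\sum_(c < 3) f i c * g j c) *: (X i * Y j).
  under [RHS]eq_bigr => i _ do under eq_bigr => j _ do rewrite scaler_suml.
  under [RHS]eq_bigr => i _ do rewrite exchange_big /=.
  rewrite [RHS]exchange_big; apply: eq_bigr => c _ /=.
  rewrite mulr_suml; apply: eq_bigr => i _; rewrite mulr_sumr; apply: eq_bigr => j _.
  by rewrite opZMl opZMr scalerA.
rewrite (prodE (fun j h' => ikW q (x ord_max) z j h k h')
               (fun j' h' => ikW q (x ord_max) v j' h' b l)).
(* The induction hypothesis exchanges the parts of the columns below the top row. The coefficient of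
   [CC n m] is then the left side of the Yang-Baxter equation for the top row. *)
transitivity (\sum_(n < 3) \sum_(m < 3) (\sum_(j < 3) \sum_(j' < 3) \sum_(h' < 3)
    ikW q v z m n j j' * (ikW q (x ord_max) z j h k h'
                          * ikW q (x ord_max) v j' h' b l)) *: CC n m).
  under [RHS]eq_bigr => n _ do under eq_bigr => m _ do
    (rewrite scaler_suml; under eq_bigr => j _ do rewrite scaler_suml).
  rewrite exchange_big22; apply: eq_bigr => j _; apply: eq_bigr => j' _.
  rewrite IH scaler_sumr; apply: eq_bigr => n _; rewrite scaler_sumr.
  apply: eq_bigr => m _; rewrite scalerA mulr_suml; congr (_ *: _).
  by apply: eq_bigr => h' _; rewrite mulrC.
under eq_bigr => n _ do under eq_bigr => m _ do
  rewrite (yang_baxter _ _ _ _ _ _ (xz _).1 (xz _).2 (xv _).1 (xv _).2 vz2 vz3).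
under eq_bigr => n _ do under eq_bigr => m _ do
  (rewrite scaler_suml; under eq_bigr => j _ do rewrite scaler_suml).
rewrite exchange_big22; apply: eq_bigr => b' _; apply: eq_bigr => j _.
rewrite (prodE (fun n h' => ikW q (x ord_max) v n h b' h')
               (fun m h' => ikW q (x ord_max) z m h' j l)).
rewrite scaler_sumr; apply: eq_bigr => n _; rewrite scaler_sumr.
apply: eq_bigr => m _; rewrite scalerA; congr (_ *: _).
by rewrite mulr_sumr; apply: eq_bigr => h' _; rewrite mulrC.
Qed.
End ColumnOperator.

(** * Hopping operators *)

Section Hopping.
Variables (F : fieldType) (q : F) (N : nat) (x : 'I_N -> F).
Notation op := (tensor_op F N).

(** A white hop takes a site from 0 to 1, a black hop from 1 to 2. *)
Definition uin (u : bool) : 'I_3 := if u then 1 else 0.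
Definition uout (u : bool) : 'I_3 := if u then 2 else 1.

Definition dsite (y z : F) : 'I_3 -> F :=
  tri 1 ((y - z) / (y - q ^+ 2 * z))
    ((y - z) * (y - q * z) / ((y - q ^+ 2 * z) * (y - q ^+ 3 * z))).

Definition dsite_dot (u : bool) (y z : F) : 'I_3 -> F :=
  if u then tri 1 ((1 + q) / (q * y - z)) ((y - q ^+ 2 * z) / (y - z))
  else tri 1 ((q * y - z) * (y - q ^+ 2 * z) / ((1 + q) * (y - z)))
         ((y - q ^+ 3 * z) / (y - q * z)).

Definition dsite_bw (y z : F) : 'I_3 -> F :=
  tri 1 ((y - q ^+ 2 * z) / (y - z))
    ((y - q ^+ 2 * z) * (y - q ^+ 3 * z) / ((y - z) * (y - q * z))).

Definition diagop (f : 'I_N -> 'I_3 -> F) : op := prodop (fun i => dgm (f i)).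

Lemma diagopM f g : diagop f * diagop g = diagop (fun i a => f i a * g i a).
Proof. by rewrite prodopM; apply: eq_prodop => i; rewrite dgm_mul. Qed.

Lemma eq_diagop f g : (forall i a, f i a = g i a) -> diagop f = diagop g.
Proof.
move=> fg; apply: eq_prodop => i; congr diag_mx.
by apply/matrixP => a b; rewrite !mxE fg.
Qed.

Lemma diagopE f s t : ent (diagop f) s t = (\prod_i f i (s i)) *+ (s == t).
Proof.
rewrite mkopE; case: eqP => [<-|ne_st].
  by apply: eq_bigr => i _; rewrite dgmE eqxx.
have /existsP[i ne_i] : [exists i, s i != t i].
  rewrite -negb_forall; apply/forallP => st; apply: ne_st.
  by apply/ffunP => i; apply/eqP.
by rewrite (bigD1 i) //= dgmE (negbTE ne_i) mul0r.
Qed.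

(** The summand of [Gamma1] at site [i] without its scalar and without the factors [d_j(z)]. It does
    not depend on [z], so [z] enters only through coefficients and through [Gamma0]. *)
Definition hop (u : bool) (i : 'I_N) : op :=
  prodop (fun j => if j == i then delta_mx (uout u) (uin u)
                   else dgm (dsite_dot u (x j) (x i))).

Definition hop_bw (i : 'I_N) : op :=
  prodop (fun j => if j == i then delta_mx 2 0 else dgm (dsite_bw (x j) (x i))).

Definition hop2 (u v : bool) (i j : 'I_N) : op :=
  prodop (fun k => if k == i then delta_mx (uout u) (uin u)
                   else if k == j then delta_mx (uout v) (uin v)
                   else dgm (fun a => dsite_dot u (x k) (x i) a
                                      * dsite_dot v (x k) (x j) a)).

(** The scalar that arises when the dressing of each hop meets the matrix unit of the other: the
    right factor sees site [i] before its hop, the left factor sees site [j] after its hop. *)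
Definition cross u v i j : F :=
  dsite_dot v (x i) (x j) (uin u) * dsite_dot u (x j) (x i) (uout v).

Lemma hopM u v i j : i != j -> hop u i * hop v j = cross u v i j *: hop2 u v i j.
Proof.
move=> ne_ij; have ne_ji : j != i by rewrite eq_sym.
rewrite prodopM; apply: (prodopZ2 ne_ij).
- by rewrite eqxx (negbTE ne_ij) delta_dgm.
- by rewrite eqxx (negbTE ne_ji) dgm_delta.
- by move=> k /negbTE-> /negbTE->; rewrite dgm_mul.
Qed.

Lemma hop2C u v i j : i != j -> hop2 u v i j = hop2 v u j i.
Proof.
move=> ne_ij; apply: eq_prodop => k.
have [->|ne_ki] := eqVneq k i; first by rewrite (negbTE ne_ij).
case: eqP => // _; congr diag_mx.
by apply/matrixP => a b; rewrite !mxE mulrC.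
Qed.

Lemma diag_hop f u i r : f i (uout u) = r * f i (uin u) ->
  diagop f * hop u i = r *: (hop u i * diagop f).
Proof.
move=> fr; rewrite !prodopM; apply: (@prodopZ1 _ _ i).
  by rewrite eqxx dgm_delta delta_dgm fr scalerA.
by move=> j /negbTE->; rewrite !dgm_mul; congr diag_mx;
  apply/matrixP => a b; rewrite !mxE mulrC.
Qed.

Lemma diag_hop_bw f i r : f i 2 = r * f i 0 ->
  diagop f * hop_bw i = r *: (hop_bw i * diagop f).
Proof.
move=> fr; rewrite !prodopM; apply: (@prodopZ1 _ _ i).
  by rewrite eqxx dgm_delta delta_dgm fr scalerA.
by move=> j /negbTE->; rewrite !dgm_mul; congr diag_mx;
  apply/matrixP => a b; rewrite !mxE mulrC.
Qed.

Lemma diag_hop2 f u v i j r r' : i != j ->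
    f i (uout u) = r * f i (uin u) -> f j (uout v) = r' * f j (uin v) ->
  diagop f * hop2 u v i j = (r * r') *: (hop2 u v i j * diagop f).
Proof.
move=> ne_ij fr fr'; have ne_ji : j != i by rewrite eq_sym.
rewrite !prodopM; apply: (prodopZ2 ne_ij).
- by rewrite eqxx dgm_delta delta_dgm fr scalerA.
- by rewrite eqxx (negbTE ne_ji) dgm_delta delta_dgm fr' scalerA.
by move=> k /negbTE-> /negbTE->; rewrite !dgm_mul; congr diag_mx;
  apply/matrixP => a b; rewrite !mxE mulrC.
Qed.

Definition lin (a : bool -> 'I_N -> F) : op := \sum_u \sum_i a u i *: hop u i.

(** The operators that raise the weight by two. The restriction to [i < j] lists each pair once, as
    [hop2] is symmetric under a simultaneous swap of colours and sites. *)
Definition quad (c : bool -> bool -> 'I_N -> 'I_N -> F) (e : 'I_N -> F) : op :=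
  \sum_i e i *: hop_bw i
  + \sum_u \sum_v \sum_(i < N) \sum_(j < N | (i < j)%N) c u v i j *: hop2 u v i j.

Lemma eq_lin a b : (forall u i, a u i = b u i) -> lin a = lin b.
Proof. by move=> ab; apply: eq_bigr => u _; apply: eq_bigr => i _; rewrite ab. Qed.

Lemma eq_quad c e c' e' :
    (forall u v i j, i != j -> c u v i j = c' u v i j) ->
    (forall i, e i = e' i) -> quad c e = quad c' e'.
Proof.
move=> cc ee; congr (_ + _); apply: eq_bigr => u _; first by rewrite ee.
apply: eq_bigr => v _; apply: eq_bigr => i _; apply: eq_bigr => j lt_ij.
by rewrite cc // -val_eqE neq_ltn lt_ij.
Qed.

Lemma linD a b : lin a + lin b = lin (fun u i => a u i + b u i).
Proof.
rewrite -big_split; apply: eq_bigr => u _; rewrite -big_split.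
by apply: eq_bigr => i _; rewrite scalerDl.
Qed.

Lemma linZ r a : r *: lin a = lin (fun u i => r * a u i).
Proof.
rewrite scaler_sumr; apply: eq_bigr => u _; rewrite scaler_sumr.
by apply: eq_bigr => i _; rewrite scalerA.
Qed.

Lemma quadD c e c' e' : quad c e + quad c' e'
  = quad (fun u v i j => c u v i j + c' u v i j) (fun i => e i + e' i).
Proof.
rewrite addrACA -!big_split; congr (_ + _); apply: eq_bigr => u _.
  by rewrite scalerDl.
rewrite -big_split; apply: eq_bigr => v _; rewrite -big_split.
apply: eq_bigr => i _; rewrite -big_split; apply: eq_bigr => j _.
by rewrite scalerDl.
Qed.

Lemma quadZ r c e :
  r *: quad c e = quad (fun u v i j => r * c u v i j) (fun i => r * e i).
Proof.
rewrite scalerDr !scaler_sumr; congr (_ + _); apply: eq_bigr => u _.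
  by rewrite scalerA.
rewrite scaler_sumr; apply: eq_bigr => v _; rewrite scaler_sumr.
apply: eq_bigr => i _; rewrite scaler_sumr; apply: eq_bigr => j _.
by rewrite scalerA.
Qed.

Lemma diag_lin f r a : (forall u i, f i (uout u) = r u i * f i (uin u)) ->
  diagop f * lin a = lin (fun u i => r u i * a u i) * diagop f.
Proof.
move=> fr; rewrite mulr_sumr mulr_suml; apply: eq_bigr => u _.
rewrite mulr_sumr mulr_suml; apply: eq_bigr => i _.
by rewrite opZMr (diag_hop (fr u i)) opZMl scalerA mulrC.
Qed.

Lemma diag_quad f r c e : (forall u i, f i (uout u) = r u i * f i (uin u)) ->
  diagop f * quad c e =
  quad (fun u v i j => r u i * r v j * c u v i j)
    (fun i => r true i * r false i * e i) * diagop f.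
Proof.
move=> fr; rewrite mulrDr mulrDl !mulr_sumr !mulr_suml; congr (_ + _).
  apply: eq_bigr => i _; rewrite opZMr (@diag_hop_bw f i (r true i * r false i)).
    by rewrite opZMl scalerA mulrC.
  by rewrite -mulrA -(fr false i) (fr true i).
apply: eq_bigr => u _; rewrite !mulr_sumr mulr_suml; apply: eq_bigr => v _.
rewrite !mulr_sumr mulr_suml; apply: eq_bigr => i _.
rewrite !mulr_sumr mulr_suml; apply: eq_bigr => j lt_ij.
have ne_ij : i != j by rewrite -val_eqE neq_ltn lt_ij.
by rewrite opZMr (diag_hop2 ne_ij (fr u i) (fr v j)) opZMl scalerA mulrC.
Qed.

Definition separated :=
  [/\ 1 + q != 0, 1 - q != 0, q != 0 &
   forall i j, i != j -> (x i - x j != 0) /\ (x i - q * x j != 0)].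

Hypothesis sep : separated.

Lemma sep_qsub i j : i != j -> q * x i - x j != 0.
Proof.
case: sep => _ _ _ sx ne_ij.
by rewrite -oppr_eq0 opprB; apply: (sx _ _ _).2; rewrite eq_sym.
Qed.

(** At site [i] the matrix units compose only if a white hop is followed by a black one. On the
    other sites the black and white dressings then multiply to the one of [hop_bw]. *)
Lemma hopM_same u v i : hop u i * hop v i = if u && ~~ v then hop_bw i else 0.
Proof.
rewrite prodopM; case: ifP => [/andP[]|uv].
  case: u v => [] [] // _ _; apply: eq_prodop => j.
  have [_|ne_ji] := eqVneq j i; first by rewrite mul_delta_mx.
  rewrite dgm_mul; congr diag_mx; apply/matrixP => a b; rewrite !mxE /dsite_bw /dsite_dot.
  have [q1 _ _ sx] := sep; have [x1 x2] := sx _ _ ne_ji; have x3 := sep_qsub ne_ji.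
  by have [->|->|->] := ord3P b; rewrite /tri /=; field; rewrite ?x1 ?x2 ?x3 ?q1.
apply: opP => s t; rewrite mkopE ent0 (bigD1 i) //= eqxx mul_delta_mx_cond.
have -> : (uin u == uout v) = false by case: u v uv => [] [].
by rewrite mulr0n mxE mul0r.
Qed.

(** Two hops at distinct sites occur in both orders, and [hop2C] brings both to the same [hop2],
    whence two terms in each coefficient; hops at a common site give the [hop_bw] part. *)
Lemma lin_mul a b : lin a * lin b =
  quad (fun u v i j => a u i * b v j * cross u v i j
                       + a v j * b u i * cross v u j i)
    (fun i => a true i * b false i).
Proof.
pose f u v i j := a u i * b v j * cross u v i j.
have -> : lin a * lin b = \sum_u \sum_v \sum_i \sum_j
    (a u i * b v j) *: (hop u i * hop v j).
  rewrite mulr_suml; apply: eq_bigr => u _; rewrite mulr_suml.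
  under eq_bigr do rewrite mulr_sumr.
  rewrite exchange_big; apply: eq_bigr => v _; apply: eq_bigr => i _.
  by rewrite mulr_sumr; apply: eq_bigr => j _; rewrite opZMl opZMr scalerA.
have split_sum u v : \sum_i \sum_j (a u i * b v j) *: (hop u i * hop v j)
   = \sum_i (a u i * b v i) *: (if u && ~~ v then hop_bw i else 0)
     + \sum_(i < N) \sum_(j < N | (i < j)%N) f u v i j *: hop2 u v i j
     + \sum_(i < N) \sum_(j < N | (i < j)%N) f u v j i *: hop2 v u i j.
  have -> : \sum_(i < N) \sum_(j < N | (i < j)%N) f u v j i *: hop2 v u i j
          = \sum_(i < N) \sum_(j < N | (j < i)%N) f u v i j *: hop2 u v i j.
    rewrite (exchange_big_dep predT) //=; apply: eq_bigr => i _.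
    by apply: eq_bigr => j lt_ij; rewrite hop2C // -val_eqE neq_ltn lt_ij.
  rewrite -!big_split; apply: eq_bigr => i _.
  rewrite (bigD1 i) //= hopM_same -addrA; congr (_ + _).
  rewrite (bigID (fun j : 'I_N => (i < j)%N)) /=; congr (_ + _).
    apply: eq_big => [j|j /andP[ne_ji _]]; last by rewrite hopM 1?eq_sym // scalerA.
    by have [->|//] := eqVneq j i; rewrite ltnn.
  apply: eq_big => [j|j /andP[ne_ji _]]; last by rewrite hopM 1?eq_sym // scalerA.
  by rewrite -leqNgt leq_eqVlt val_eqE; have [->|//] := eqVneq j i; rewrite ltnn.
under eq_bigr do under eq_bigr do rewrite split_sum.
under eq_bigr do rewrite !big_split.
rewrite !big_split /= -addrA; congr (_ + _).
  rewrite !big_bool /= ![\sum_i _ *: 0]big1 ?addr0 ?add0r // => i _;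
  by rewrite scaler0.
rewrite [X in _ + X]exchange_big -big_split; apply: eq_bigr => u _ /=.
rewrite -big_split; apply: eq_bigr => v _; rewrite -big_split; apply: eq_bigr => i _.
by rewrite -big_split; apply: eq_bigr => j _; rewrite scalerDl.
Qed.

End Hopping.
Arguments diag_lin {F q N x f r} a fr.
Arguments diag_quad {F q N x f r} c e fr.

(** * The twisted column operators in terms of hopping operators *)

Section GammaHopping.
Variables (F : fieldType) (q : F) (N : nat) (x : 'I_N -> F).
Notation op := (tensor_op F N).

Definition gam0 (z : F) : op := diagop (fun i => dsite q (x i) z).

(** The scalar of [e_dot u] at parameter [y] divided by the entry of [dsite] at the incoming state.
    The common factor [y - z] of the black case is cancelled, so [y = z] is allowed. *)
Definition jsite (y z : F) (u : bool) : F :=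
  if u then q * (1 - q) * (1 - q ^+ 2) * z / (y - q ^+ 3 * z)
  else (1 - q ^+ 2) * z / (y - q ^+ 2 * z).

Definition jcoef (z : F) (u : bool) (i : 'I_N) : F := jsite (x i) z u.

(** The outgoing over the incoming entry of [d_i(z)]: the scalar produced when [Gamma0] is moved to
    the right past a hop. *)
Definition dratio (z : F) (u : bool) (i : 'I_N) : F :=
  if u then (x i - q * z) / (x i - q ^+ 3 * z) else (x i - z) / (x i - q ^+ 2 * z).

Definition bwcoef (z : F) (i : 'I_N) : F :=
  (1 - q ^+ 2) * (x i + q ^+ 2 * x i - q ^+ 2 * z - q ^+ 3 * z) * z
     / ((x i - q ^+ 2 * z) * (x i - q ^+ 3 * z)).

Definition paircoef (z : F) (u v : bool) (i j : 'I_N) : F :=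
  match u, v with
  | false, false =>
    (x i * x j + q ^+ 2 * x i * x j - q ^+ 2 * x i * z - q ^+ 2 * x j * z)
     / ((1 - q ^+ 2) * z)
  | true, false =>
    (x i * x j + q ^+ 2 * x i * x j - q ^+ 2 * x i * z - q ^+ 3 * x j * z)
     / (q * (1 - q) * (x i - x j) * z)
  | false, true =>
    (x j * x i + q ^+ 2 * x j * x i - q ^+ 2 * x j * z - q ^+ 3 * x i * z)
     / (q * (1 - q) * (x j - x i) * z)
  | true, true =>
    (1 + q)
     * (x i * x j + q ^+ 2 * x i * x j - q ^+ 3 * x i * z - q ^+ 3 * x j * z)
     / (q * (1 - q) * (x i - q * x j) * (x j - q * x i) * z)
  end.

Definition kcoef z u v i j := paircoef z u v i j * jcoef z u i * jcoef z v j.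

Lemma d_E i z : d_ q x i z =
  prodop (fun j => if j == i then dgm (dsite q (x i) z) else 1%:M).
Proof. exact: local_opE. Qed.

Lemma d_dotE u i z : d_dot q x u i z =
  prodop (fun j => if j == i then dgm (dsite_dot q u (x i) z) else 1%:M).
Proof. by case: u; apply: local_opE. Qed.

Lemma d_bwE i z : d_bw q x i z =
  prodop (fun j => if j == i then dgm (dsite_bw q (x i) z) else 1%:M).
Proof. exact: local_opE. Qed.

Lemma Gamma0E z : Gamma0 q x z = gam0 z.
Proof.
rewrite /Gamma0; under eq_bigr do rewrite d_E.
rewrite (@prod_prodop _ _ predT (fun i j => if j == i then _ else _));
  last by move=> i j _ /negbTE->.
by apply: eq_prodop => j; rewrite /= eqxx.
Qed.

Hypothesis sep : separated q x.

Variable z : F.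
Hypothesis adm : admissible q x z.

Lemma dsite_ratio u i :
  dsite q (x i) z (uout u) = dratio z u i * dsite q (x i) z (uin u).
Proof.
have [_ xz] := adm; have [x2 x3] := xz i.
by case: u; rewrite /dratio /dsite /tri /=; field; rewrite ?x2 ?x3.
Qed.

Lemma e_dotE u i : e_dot q x u i z =
  prodop (fun j => if j == i
    then (jcoef z u i * dsite q (x i) z (uin u)) *: delta_mx (uout u) (uin u)
    else 1%:M).
Proof.
have [_ xz] := adm; have [x2 x3] := xz i; case: u; rewrite /= /e_w /e_b local_opE.
  symmetry; apply: (@prodopZ1 _ _ i) => [|j /negbTE->] //; rewrite eqxx /jcoef /jsite.
  by congr (_ *: _); rewrite /dsite /tri /=; field; rewrite ?x2 ?x3.
symmetry; apply: (@prodopZ1 _ _ i) => [|j /negbTE->] //; rewrite eqxx /jcoef /jsite.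
by congr (_ *: _); rewrite /dsite /tri /=; field; rewrite ?x2 ?x3.
Qed.

(** With the diagonal factors gathered on the right as [gam0 z], relations between column operators
    reduce to rational identities between coefficients of hops, each involving at most two sites. *)
Lemma Gamma1E : Gamma1 q x z = lin q x (jcoef z) * gam0 z.
Proof.
rewrite mulr_suml; apply: eq_bigr => u _; rewrite mulr_suml; apply: eq_bigr => i _.
rewrite e_dotE.
under eq_bigr => j _ do rewrite d_E d_dotE prodopM.
rewrite (@prod_prodop _ _ (fun j => j != i)
  (fun j k => (if k == j then _ else _) *m (if k == j then _ else _)))
  => [|j k _ /negbTE->]; last by rewrite mulmx1.
rewrite opZMl !prodopM; apply: (@prodopZ1 _ _ i).
  by rewrite eqxx mulmx1 delta_dgm scalerA.
by move=> j /negbTE ne_ji; rewrite ne_ji /= eqxx mul1mx !dgm_mul; congr diag_mx;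
  apply/matrixP => a b; rewrite !mxE mulrC.
Qed.

Lemma Gamma2E : Gamma2 q x z = quad q x (kcoef z) (bwcoef z) * gam0 z.
Proof.
rewrite mulrDl !mulr_suml; congr (_ + _); apply: eq_bigr => u _.
  rewrite /e_bw local_opE.
  under eq_bigr => j _ do rewrite d_E d_bwE prodopM.
  rewrite (@prod_prodop _ _ (fun j => j != u)
    (fun j k => (if k == j then _ else _) *m (if k == j then _ else _)))
    => [|j k _ /negbTE->]; last by rewrite mulmx1.
  rewrite !opZMl !prodopM; congr (_ *: _); apply: eq_prodop => j.
  case: eqP => [->|_] /=; first by rewrite mulmx1 delta_dgm /dsite /tri /= scale1r.
  by rewrite eqxx mul1mx !dgm_mul; congr diag_mx;
  apply/matrixP => a b; rewrite !mxE mulrC.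
rewrite mulr_suml; apply: eq_bigr => v _; rewrite mulr_suml; apply: eq_bigr => i _.
rewrite mulr_suml; apply: eq_bigr => j lt_ij.
have ne_ij : i != j by rewrite -val_eqE neq_ltn lt_ij.
have ne_ji : j != i by rewrite eq_sym.
rewrite /kcoef -!mulrA opZMl -scalerA.
under eq_bigr => k _ do rewrite d_E !d_dotE !prodopM.
rewrite (@prod_prodop _ _ (fun k => (k != i) && (k != j))
  (fun k l => (if l == k then _ else _) *m (if l == k then _ else _)
     *m (if l == k then _ else _)))
  => [|k l _ /negbTE->]; last by rewrite !mulmx1.
have -> : e_dot2 q x u v i j z = paircoef z u v i j *: prodop (fun k =>
  if k == i then (jcoef z u i * dsite q (x i) z (uin u)) *: delta_mx (uout u) (uin u)
  else if k == j then (jcoef z v j * dsite q (x j) z (uin v)) *: delta_mx (uout v) (uin v)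
  else 1%:M).
  have ee a b c d : c != d -> e_dot q x a c z * e_dot q x b d z = prodop (fun k =>
      if k == c then (jcoef z a c * dsite q (x c) z (uin a)) *: delta_mx (uout a) (uin a)
      else if k == d
        then (jcoef z b d * dsite q (x d) z (uin b)) *: delta_mx (uout b) (uin b)
      else 1%:M).
    move=> /negbTE ne; rewrite !e_dotE prodopM; apply: eq_prodop => k.
    by have [->|] := eqVneq k c; rewrite ?ne ?mulmx1 ?mul1mx.
  case: u v => [] [] /=; rewrite -?(ee true true i j)
    -?(ee false false i j) -?(ee true false i j) //.
  rewrite /e_w_b /e_b_w -/(e_dot q x true j z) -/(e_dot q x false i z).
  rewrite [e_b _ _ _ _ * _](ee true false j i) //; congr (_ *: _).
  apply: eq_prodop => k.
  by have [->|//] := eqVneq k j; rewrite (negbTE ne_ji).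
rewrite opZMl; congr (_ *: _); rewrite !prodopM; apply: (prodopZ2 ne_ij).
- by rewrite !eqxx /= mulmx1 delta_dgm scalerA.
- by rewrite !eqxx (negbTE ne_ji) /= mulmx1 delta_dgm scalerA.
move=> k /negbTE-> /negbTE->; rewrite /= eqxx mul1mx !dgm_mul; congr diag_mx.
by apply/matrixP => a b; rewrite !mxE; ring.
Qed.

End GammaHopping.

(** * The partial twist *)

Section TwistRows.
Variables (F : fieldType) (q : F) (N : nat) (y : 'I_N -> F) (w z : F).
Notation op := (tensor_op F N).

Hypotheses (sep : separated q y).
Hypotheses (wz2 : w - q ^+ 2 * z != 0) (wz3 : w - q ^+ 3 * z != 0).
Hypotheses (admz : admissible q y z) (admw : admissible q y w).
Hypotheses (yw1 : forall i, (y i - w != 0) /\ (y i - q * w != 0))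
  (yw2 : forall i, q * y i - w != 0).

(** The site factor of the inverse of [dot_diag true], which is also that of [dot_diag false] times
    [gam0 w]. The blocks of [Gamma1] next to the diagonal require both properties. *)
Definition twist_site (i : 'I_N) : 'I_3 -> F :=
  tri 1 ((q * y i - w) / (1 + q)) ((y i - w) / (y i - q ^+ 2 * w)).

Definition twist_diag : op := diagop twist_site.

(* The second row (0, twist_diag, lin twist_coef * twist_diag) of the twist is,
   up to a diagonal left factor, ((1 - q) Gamma_0(w/q), Gamma_1(w/q)). *)
Definition twist_coef (u : bool) (i : 'I_N) : F :=
  if u then (1 - q ^+ 2) * (1 + q) * w / ((y i - q ^+ 2 * w) * (q * y i - w)) else w.

Definition dot_diag (u : bool) : op := diagop (fun i => dsite_dot q u (y i) w).

Notation gz := (gam0 q y z).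
Notation gw := (gam0 q y w).
Notation jz := (jcoef q y z).
Notation jw := (jcoef q y w).
Notation kz := (kcoef q y z).
Notation kw := (kcoef q y w).
Notation L := (lin q y).
Notation W := (ikW q w z).

Lemma diagopC f g : diagop f * diagop g = diagop g * diagop f :> op.
Proof. by rewrite !diagopM; apply: eq_diagop => i a; rewrite mulrC. Qed.

Let q1 : 1 + q != 0. Proof. by case: sep. Qed.
Let q2 : 1 - q != 0. Proof. by case: sep. Qed.
Let q0 : q != 0. Proof. by case: sep. Qed.
Let z0 : z != 0. Proof. by case: admz. Qed.
Let w0 : w != 0. Proof. by case: admw. Qed.
Let sep_pair i j : i != j -> (y i - y j != 0) /\ (y i - q * y j != 0).
Proof. by case: sep => _ _ _; apply. Qed.
Let yz2 i : y i - q ^+ 2 * z != 0. Proof. by case: admz => _ /(_ i) []. Qed.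
Let yz3 i : y i - q ^+ 3 * z != 0. Proof. by case: admz => _ /(_ i) []. Qed.
Let yww2 i : y i - q ^+ 2 * w != 0. Proof. by case: admw => _ /(_ i) []. Qed.
Let yww3 i : y i - q ^+ 3 * w != 0. Proof. by case: admw => _ /(_ i) []. Qed.
Let yw i : y i - w != 0. Proof. exact: (yw1 i).1. Qed.
Let ywq i : y i - q * w != 0. Proof. exact: (yw1 i).2. Qed.
Let q21 : 1 - q ^+ 2 != 0.
Proof. exact: one_sub_sqr_neq0. Qed.
Let wy i : w - y i != 0. Proof. by rewrite -oppr_eq0 opprB. Qed.
Let wqy i : w - q * y i != 0. Proof. by rewrite -oppr_eq0 opprB. Qed.
Let qwy i : q * w - y i != 0. Proof. by rewrite -oppr_eq0 opprB. Qed.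

Let orient_w i : ((w - y i = - (y i - w)) * (w - q * y i = - (q * y i - w))
  * (q * w - y i = - (y i - q * w)))%type.
Proof. by rewrite !opprB. Qed.

Ltac nz := rewrite ?q0 ?q1 ?q2 ?q21 ?z0 ?w0 ?yz2 ?yz3 ?yww2 ?yww3 ?yw ?ywq ?yw2
  ?wz2 ?wz3 ?wy ?wqy ?qwy.

Definition twist_ratio u i : F :=
  if u then (y i - w) * (1 + q) / ((y i - q ^+ 2 * w) * (q * y i - w))
  else (q * y i - w) / (1 + q).

Let rtwist u i : twist_site i (uout u) = twist_ratio u i * twist_site i (uin u).
Proof. by case: u; rewrite /twist_ratio /twist_site /tri /=; field; nz. Qed.

Definition dot_ratio u u' i : F :=
  match u, u' with
  | false, false => (q * y i - w) * (y i - q ^+ 2 * w) / ((1 + q) * (y i - w))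
  | false, true => (y i - q ^+ 3 * w) * (1 + q) * (y i - w)
                     / ((y i - q * w) * (q * y i - w) * (y i - q ^+ 2 * w))
  | true, false => (1 + q) / (q * y i - w)
  | true, true => (y i - q ^+ 2 * w) * (q * y i - w) / ((1 + q) * (y i - w))
  end.

Let rdot u u' i :
  dsite_dot q u (y i) w (uout u') = dot_ratio u u' i * dsite_dot q u (y i) w (uin u').
Proof. by case: u u' => [] []; rewrite /dot_ratio /dsite_dot /tri /=; field; nz. Qed.

Lemma dot_diag_gam : dot_diag false * gw = twist_diag.
Proof.
rewrite diagopM; apply: eq_diagop => i a.
by have [->|->|->] := ord3P a; rewrite /twist_site /dsite_dot /dsite /tri /=; field; nz.
Qed.

Lemma dot_diag_twist : dot_diag true * twist_diag = 1.
Proof.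
rewrite diagopM -prodop1; apply: eq_prodop => i; apply/matrixP => a b.
rewrite dgmE mxE; congr (_ *+ _).
by have [->|->|->] := ord3P a; rewrite /twist_site /dsite_dot /tri /=; field; nz.
Qed.

(** With rows and columns counted from 0, this is entry (1, 2) of the intertwining relation for k =
    0. All terms are single hops times a common diagonal operator, so coefficients are compared hop
    by hop. *)
Lemma twist_row1_01 : W 1 1 0 2 *: (twist_diag * (L jz * gz))
   + W 0 2 0 2 *: (L twist_coef * twist_diag * gz)
  = dsite q w z 1 *: (gz * (L twist_coef * twist_diag)).
Proof.
rewrite !mulrA (diag_lin _ rtwist) (diag_lin _ (dsite_ratio admz)) -!mulrA.
rewrite [gz * _]diagopC -!opZMl -mulrDl !linZ linD.
congr (_ * _); apply: eq_lin => u i.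
by case: u; rewrite /dratio /jcoef /jsite /twist_coef /twist_ratio /ikW /dsite
  /tri /=; field; nz.
Qed.

Lemma dot_diag_lin : dot_diag false * gz * (L jw * gw)
  = L (fun u i => dot_ratio false u i * (dratio q y z u i * jw u i)) * (twist_diag * gz).
Proof.
rewrite -!mulrA [gz * _]mulrA (diag_lin _ (dsite_ratio admz)) -!mulrA mulrA.
rewrite (diag_lin _ (rdot false)) -!mulrA; congr (_ * _).
by rewrite [gz * gw]diagopC mulrA dot_diag_gam.
Qed.

(** Entry (1, 1) for k = 1, again an identity between coefficients of single hops. *)
Lemma twist_row1_11 : W 1 1 1 1 *: (twist_diag * (L jz * gz))
   + W 0 2 1 1 *: (L twist_coef * twist_diag * gz)
  = L (fun u i => dsite_dot q u w (y i) 1 * jz u i) * (dsite q w z 1 *: gz) * twist_diag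
   + jsite q w z false *: (dot_diag false * gz * (L jw * gw)).
Proof.
rewrite dot_diag_lin !mulrA (diag_lin _ rtwist) -!mulrA.
rewrite [_ *: gz * _]opZMl [gz * _]diagopC opZMr -!opZMl -!mulrDl !linZ !linD.
congr (_ * _); apply: eq_lin => u i.
by case: u; rewrite /dratio /jcoef /jsite /twist_coef /twist_ratio /dot_ratio
  /ikW /dsite /dsite_dot
  /tri /= ?orient_w ?(mulrN, mulNr, invrN); field; nz.
Qed.

(** Entry (1, 2) for k = 1. Here products of two hops meet [Gamma2] at both [z] and [w]; after all
    diagonal operators are moved to the right, the coefficients are compared for every pair of sites
    and for every double hop. *)
Lemma twist_row1_12 : W 2 1 1 2 *: (twist_diag * (quad q y (kz) (bwcoef q y z) * gz))
   + W 1 2 1 2 *: (L twist_coef * twist_diag * (L jz * gz))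
  = L (fun u i => dsite_dot q u w (y i) 1 * jz u i) * (dsite q w z 1 *: gz) *
      (L twist_coef * twist_diag)
   + jsite q w z false *:
     (dot_diag false * gz * (quad q y kw (bwcoef q y w) * gw)).
Proof.
have -> : dot_diag false * gz * (quad q y kw (bwcoef q y w) * gw)
  = quad q y (fun u v i j => dot_ratio false u i * dot_ratio false v j *
     (dratio q y z u i * dratio q y z v j * kw u v i j))
     (fun i => dot_ratio false true i * dot_ratio false false i *
     (dratio q y z true i * dratio q y z false i * bwcoef q y w i)) * (twist_diag * gz).
  rewrite -!mulrA [gz * _]mulrA (diag_quad _ _ (dsite_ratio admz)) -!mulrA mulrA.
  rewrite (diag_quad _ _ (rdot false)) -!mulrA; congr (_ * _).
  by rewrite [gz * gw]diagopC mulrA dot_diag_gam.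
have -> : twist_diag * (quad q y kz (bwcoef q y z) * gz) =
    quad q y (fun u v i j => twist_ratio u i * twist_ratio v j * kz u v i j)
      (fun i => twist_ratio true i * twist_ratio false i * bwcoef q y z i)
    * (twist_diag * gz).
  by rewrite mulrA (diag_quad _ _ rtwist) -mulrA.
have -> : L twist_coef * twist_diag * (L jz * gz) =
    L twist_coef * L (fun u i => twist_ratio u i * jz u i) * (twist_diag * gz).
  by rewrite -!mulrA; congr (_ * _); rewrite mulrA (diag_lin _ rtwist) -mulrA.
have -> a d : L a * (d *: gz) * (L twist_coef * twist_diag) =
    (d *: (L a * L (fun u i => dratio q y z u i * twist_coef u i)))
    * (twist_diag * gz).
  rewrite opZMr !opZMl -!mulrA [gz * (_ * _)]mulrA.
  rewrite (diag_lin _ (dsite_ratio admz)) -!mulrA.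
  by rewrite [gz * _]diagopC.
rewrite !(lin_mul sep) -!opZMl -!mulrDl !quadZ !quadD; congr (_ * _).
apply: eq_quad => [u v i j ne_ij|i].
  have ne_ji : j != i by rewrite eq_sym.
  have [y1 y2] := sep_pair ne_ij; have [y3 y4] := sep_pair ne_ji.
  have y5 := sep_qsub sep ne_ij; have y6 := sep_qsub sep ne_ji.
  (* Orienting the differences lets [field] identify denominators up to sign. *)
  have orient : ((y j - y i = - (y i - y j)) * (y j - q * y i = - (q * y i - y j))
      * (q * y j - y i = - (y i - q * y j)))%type by rewrite !opprB.
  case: u v => [] []; rewrite /kcoef /paircoef /cross /dratio /jcoef /jsite
    /twist_coef /twist_ratio /dot_ratio /ikW /dsite /dsite_dot /tri /=
    ?orient ?orient_w ?(mulrN, mulNr, invrN);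
    by field; nz; rewrite ?y1 ?y2 ?y3 ?y4 ?y5 ?y6.
by rewrite /dratio /bwcoef /jcoef /jsite /twist_coef /twist_ratio /dot_ratio
  /ikW /dsite /dsite_dot /tri /= ?orient_w ?(mulrN, mulNr, invrN); field; nz.
Qed.

(** Entry (2, 1) for k = 1, where [dot_diag true] cancels [twist_diag]. *)
Lemma twist_row2_11 : W 0 2 1 1 *: gz
  = (jsite q w z true * dsite q w z 1) *: (dot_diag true * gz * twist_diag).
Proof.
rewrite -mulrA [gz * _]diagopC mulrA dot_diag_twist mul1r; congr (_ *: _).
by rewrite /jsite /dsite /tri /ikW /=; field; nz.
Qed.

(** Entry (2, 2) for k = 1; the same cancellation leaves single hops. *)
Lemma twist_row2_12 : W 1 2 1 2 *: (L jz * gz)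
  = L (fun u i => dsite_dot q u w (y i) 2 * jz u i) * (dsite q w z 2 *: gz)
    + (jsite q w z true * dsite q w z 1) *:
        (dot_diag true * gz * (L twist_coef * twist_diag)).
Proof.
have -> : dot_diag true * gz * (L twist_coef * twist_diag) =
    L (fun u i => dot_ratio true u i * (dratio q y z u i * twist_coef u i)) * gz.
  rewrite -mulrA [gz * _]mulrA (diag_lin _ (dsite_ratio admz)) -!mulrA mulrA.
  rewrite (diag_lin _ (rdot true)) -!mulrA [gz * _]diagopC; congr (_ * _).
  by rewrite mulrA dot_diag_twist mul1r.
rewrite opZMr -!opZMl -!mulrDl !linZ !linD; congr (_ * _); apply: eq_lin => u i.
by case: u; rewrite /dratio /jcoef /jsite /twist_coef /dot_ratio /ikW /dsite
  /dsite_dot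
  /tri /= ?orient_w ?(mulrN, mulNr, invrN); field; nz.
Qed.

End TwistRows.

Section TwistStep.
Variables (F : fieldType) (q : F) (N : nat) (x : 'I_N.+1 -> F).
Let y (i : 'I_N) := x (wid i).
Let w := x ord_max.

(** The entry at (a, b) raises the weight of the first [N] sites by b - a, so the whole operator
    preserves the weight and is block upper triangular. *)
Definition twist (a b : 'I_3) : tensor_op F N :=
  match val a, val b with
  | 0%N, _ => Gamma q y b w
  | 1%N, 1%N => twist_diag q y w
  | 1%N, 2%N => lin q y (twist_coef q y w) * twist_diag q y w
  | 2%N, 2%N => 1
  | _, _ => 0
  end.

Lemma gam0_blk z : gam0 q x z =
  blk (fun a b => (dsite q w z a *+ (a == b)) *: gam0 q y z).
Proof. by rewrite /gam0 /diagop prodop_blk; apply: eq_blk => a b; rewrite dgmE. Qed.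

Lemma hop_blk u i : hop q x u (wid i) =
  blk (fun a b => (dsite_dot q u w (y i) a *+ (a == b)) *: hop q y u i).
Proof.
rewrite /hop prodop_blk; apply: eq_blk => a b.
by rewrite eq_sym (negbTE (wid_max i)) dgmE.
Qed.

Lemma hop_blk_max u : hop q x u ord_max =
  blk (fun a b => ((a == uout u) && (b == uin u))%:R *: dot_diag q y w u).
Proof.
rewrite /hop prodop_blk; apply: eq_blk => a b; rewrite eqxx mxE; congr (_ *: _).
by apply: eq_prodop => j; rewrite (negbTE (wid_max j)).
Qed.

Lemma lin_blk c : lin q x c = blk (fun a b =>
   lin q y (fun u i => dsite_dot q u w (y i) a * c u (wid i)) *+ (a == b)
   + \sum_u (c u ord_max * ((a == uout u) && (b == uin u))%:R) *: dot_diag q y w u).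
Proof.
rewrite /lin.
under eq_bigr => u _ do (rewrite big_ord_recr /= hop_blk_max blkZ;
  under eq_bigr => i _ do rewrite hop_blk blkZ).
under eq_bigr => u _ do rewrite blk_sum blkD.
rewrite blk_sum; apply: eq_blk => a b; rewrite big_split; congr (_ + _).
  rewrite -sumrMnl; apply: eq_bigr => u _; rewrite -sumrMnl; apply: eq_bigr => i _.
  by rewrite scalerA mulrnAr scalerMnl mulrC.
by apply: eq_bigr => u _; rewrite scalerA.
Qed.

Variable z : F.
Hypotheses (sep : separated q x) (wz2 : w - q ^+ 2 * z != 0)
  (wz3 : w - q ^+ 3 * z != 0) (admz : admissible q y z) (admw : admissible q y w).

(** The diagonal blocks come from hops at the first [N] sites, those below the diagonal from a hop
    at the last site. *)
Definition gamma1_block (a b : 'I_3) : tensor_op F N :=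
  match val a, val b with
  | 0%N, 0%N => Gamma1 q y z
  | 1%N, 1%N => lin q y (fun u i => dsite_dot q u w (y i) 1 * jcoef q y z u i)
       * (dsite q w z 1 *: gam0 q y z)
  | 2%N, 2%N => lin q y (fun u i => dsite_dot q u w (y i) 2 * jcoef q y z u i)
       * (dsite q w z 2 *: gam0 q y z)
  | 1%N, 0%N => jsite q w z false *: (dot_diag q y w false * gam0 q y z)
  | 2%N, 1%N => (jsite q w z true * dsite q w z 1) *:
                  (dot_diag q y w true * gam0 q y z)
  | _, _ => 0
  end.

Let sepy : separated q y.
Proof.
case: sep => ? ? ? sx; split=> // i j ij; apply: sx.
by apply: contra ij => /eqP/wid_inj->.
Qed.

Let admx : admissible q x z.
Proof.
case: admz => z0 yz; split=> // i; have [->|[j ->]] := widP i; first by [].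
exact: yz.
Qed.

Lemma Gamma1_blk : Gamma1 q x z = blk gamma1_block.
Proof.
rewrite Gamma1E //.
rewrite gam0_blk lin_blk blkM; apply: eq_blk => a b.
rewrite big_ord3 !big_bool /gamma1_block.
have [->|->|->] := ord3P a; have [->|->|->] := ord3P b;
  rewrite /= ?(mulr0n, mulr1n, mulr0, scale0r, addr0, add0r, mulr1, mul0r) //.
- rewrite Gamma1E // /dsite /tri /= scale1r; congr (_ * _).
  by apply: eq_lin => u i; case: u; rewrite /dsite_dot /tri /= mul1r.
- by rewrite opZMr opZMl /dsite /tri /= scale1r.
- by rewrite opZMr opZMl scalerA mulrC.
Qed.

Hypotheses (yw1 : forall i, (y i - w != 0) /\ (y i - q * w != 0))
  (yw2 : forall i, q * y i - w != 0).

Hypothesis exchange : forall k b,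
  Gamma q y k z * Gamma q y b w =
  \sum_(b' < 3) \sum_(j < 3)
    ikW q w z j b' k b *: (Gamma q y b' w * Gamma q y j z).

(** The blocks of a column whose last site is still an untwisted vertex while the first [N] sites
    are already twisted. *)
Definition column_block (k a b : 'I_3) : tensor_op F N :=
  \sum_(j < 3) ikW q w z j a k b *: Gamma q y j z.

(** The first row of the twist consists of columns with parameter [w], and the vertex at the new
    site is the one at which the lines of [z] and [w] cross. The equation is therefore the exchange
    relation itself. *)
Lemma twist_row0 k b : \sum_(c < 3) twist 0 c * column_block k c b
  = Gamma q y k z * twist 0 b.
Proof.
rewrite exchange; apply: eq_bigr => c _; rewrite mulr_sumr.
by apply: eq_bigr => j _; rewrite opZMr.
Qed.

Let simp := (mulr0n, mulr1n, scale0r, scaler0, mul0r, mulr0, add0r, addr0, mul1r).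

Lemma twist_Gamma0 :
  blk twist * blk (column_block 0) = Gamma q x 0 z * blk twist.
Proof.
rewrite [Gamma q x 0 z]Gamma0E gam0_blk !blkM; apply: eq_blk => a b.
have [->|->|->] := ord3P a.
- rewrite twist_row0 big_ord3 /= !simp.
  by rewrite [Gamma q y 0 z]Gamma0E {1}/dsite /tri /= scale1r.
- have := twist_row1_01 sepy wz2 wz3 admz admw yw2.
  have [->|->|->] := ord3P b;
    rewrite !big_ord3 /column_block !big_ord3 /twist /ikW /= !simp // => r01.
  + by rewrite [Gamma q y 0 z]Gamma0E opZMr opZMl [gam0 _ _ _ * _]diagopC.
  + by rewrite [Gamma q y 0 z]Gamma0E [Gamma q y 1 z]Gamma1E // !opZMr opZMl.
have [->|->|->] := ord3P b;
  rewrite !big_ord3 /column_block !big_ord3 /twist /ikW /= !simp //.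
by rewrite mulr1 [Gamma q y 0 z]Gamma0E.
Qed.

Lemma twist_Gamma1 :
  blk twist * blk (column_block 1) = Gamma q x 1 z * blk twist.
Proof.
rewrite [Gamma q x 1 z]Gamma1_blk !blkM; apply: eq_blk => a b.
have [->|->|->] := ord3P a.
- rewrite twist_row0 big_ord3 /gamma1_block /= !simp.
  by [].
- have := twist_row1_11 sepy wz2 wz3 admz admw yw1 yw2.
  have := twist_row1_12 sepy wz2 admz admw yw1 yw2.
  have [->|->|->] := ord3P b;
    rewrite !big_ord3 /column_block !big_ord3 /twist /gamma1_block /ikW /= !simp
      => r12 r11.
  + rewrite [Gamma q y 0 z]Gamma0E [Gamma q y 0 w]Gamma0E // !opZMr opZMl.
    congr (_ *: _).
    by rewrite -mulrA [gam0 q y z * _]diagopC mulrA dot_diag_gam // [RHS]diagopC.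
  + rewrite [Gamma q y 0 z]Gamma0E [Gamma q y 1 z]Gamma1E //.
    rewrite [Gamma q y 1 w]Gamma1E // !opZMr r11.
    by rewrite addrC !opZMl !opZMr !opZMl.
  + rewrite [Gamma q y 2 z]Gamma2E // [Gamma q y 1 z]Gamma1E //.
    rewrite [Gamma q y 2 w]Gamma2E // !opZMr r12.
    by rewrite addrC !opZMl !opZMr !opZMl.
have := twist_row2_11 sepy wz2 wz3 admw yw1 yw2.
have := twist_row2_12 sepy wz2 wz3 admz admw yw1 yw2.
have [->|->|->] := ord3P b;
  rewrite !big_ord3 /column_block !big_ord3 /twist /gamma1_block /ikW /= !simp //
    => r12 r11.
- by rewrite [Gamma q y 0 z]Gamma0E r11 opZMl.
- by rewrite [Gamma q y 1 z]Gamma1E // r12 mulr1 addrC opZMl.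
Qed.

End TwistStep.

(** * Weights *)

Section Grading.
Variables (F : fieldType) (q : F) (N : nat).
Notation op := (tensor_op F N).

Definition weight (s : state N) : nat := (\sum_i s i)%N.

(** Homogeneity of degree [k] for the grading by the total weight. *)
Definition raises (k : nat) (A : op) :=
  forall s t, weight s != (weight t + k)%N -> ent A s t = 0.

Lemma raisesM k l A B : raises k A -> raises l B -> raises (k + l) (A * B).
Proof.
move=> hA hB s t st; rewrite entM big1 // => u _.
have [su|/hA->] := eqVneq (weight s) (weight u + k)%N; last by rewrite mul0r.
have [ut|/hB->] := eqVneq (weight u) (weight t + l)%N; last by rewrite mulr0.
by case/eqP: st; rewrite su ut -addnA (addnC l).
Qed.

Lemma raisesD k A B : raises k A -> raises k B -> raises k (A + B).
Proof. by move=> hA hB s t st; rewrite entD hA // hB // addr0. Qed.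

Lemma raisesZ k c A : raises k A -> raises k (c *: A).
Proof. by move=> hA s t st; rewrite entZ hA // mulr0. Qed.

Lemma raises_sum k I (r : seq I) (P : pred I) (A : I -> op) :
  (forall i, P i -> raises k (A i)) -> raises k (\sum_(i <- r | P i) A i).
Proof. by move=> hA s t st; rewrite ent_sum big1 // => i Pi; apply: hA. Qed.

Lemma raises1 : raises 0 1.
Proof. by move=> s t; rewrite addn0 ent1; case: (s =P t) => // ->; rewrite eqxx. Qed.

Lemma raises_prodop (M : 'I_N -> 'M[F]_3) (d : 'I_N -> nat) :
    (forall i (a b : 'I_3), (a : nat) != (b + d i)%N -> M i a b = 0) ->
  raises (\sum_i d i) (prodop M).
Proof.
move=> hM s t; rewrite /weight -big_split mkopE /= => st.
have /existsP[i ne_i] : [exists i, (s i : nat) != (t i + d i)%N].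
  rewrite -negb_forall; apply: contra st => /forallP sti.
  by apply/eqP; apply: eq_bigr => i _; apply/eqP.
by rewrite (bigD1 i) //= hM ?mul0r.
Qed.

Lemma raises_diagop f : raises 0 (diagop f : op).
Proof.
rewrite (_ : 0%N = (\sum_(i < N) 0)%N); last by rewrite sum_nat_const muln0.
apply: raises_prodop => i a b; rewrite addn0 => ab.
by rewrite dgmE -val_eqE (negbTE ab) mulr0n.
Qed.

Let sum_ind1 (i : 'I_N) d : (\sum_j (if j == i then d else 0) = d)%N.
Proof. by rewrite -big_mkcond big_pred1_eq. Qed.

Let ne_delta (a b a' b' : 'I_3) d : (a' : nat) = (b' + d)%N ->
  (a : nat) != (b + d)%N -> (delta_mx a' b' : 'M[F]_3) a b = 0.
Proof.
move=> ab' ab; rewrite mxE; case: (a =P a') => [aa|//]; case: (b =P b') => [bb|//].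
by rewrite aa bb ab' eqxx in ab.
Qed.

Let ne_dgm f (a b : 'I_3) : (a : nat) != (b + 0)%N -> (dgm f : 'M[F]_3) a b = 0.
Proof. by rewrite addn0 => ab; rewrite dgmE -val_eqE (negbTE ab) mulr0n. Qed.

Variable x : 'I_N -> F.

Lemma raises_hop u i : raises 1 (hop q x u i).
Proof.
rewrite -(sum_ind1 i 1); apply: raises_prodop => j a b.
by have [_|_] := eqVneq j i; [apply: ne_delta; case: u|apply: ne_dgm].
Qed.

Lemma raises_hop_bw i : raises 2 (hop_bw q x i).
Proof.
rewrite -(sum_ind1 i 2); apply: raises_prodop => j a b.
by have [_|_] := eqVneq j i; [apply: ne_delta|apply: ne_dgm].
Qed.

Lemma raises_hop2 u v i j : i != j -> raises 2 (hop2 q x u v i j).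
Proof.
move=> ne_ij.
have -> : 2%N = (\sum_k ((if k == i then 1 else 0) + (if k == j then 1 else 0)))%N.
  by rewrite big_split /= !sum_ind1.
apply: raises_prodop => k a b /=; have [->|_] := eqVneq k i.
  by rewrite (negbTE ne_ij); apply: ne_delta; case: u.
by have [_|_] := eqVneq k j; [apply: ne_delta; case: v|apply: ne_dgm].
Qed.

Lemma raises_lin a : raises 1 (lin q x a).
Proof.
by apply: raises_sum => u _; apply: raises_sum => i _; apply/raisesZ/raises_hop.
Qed.

Lemma raises_quad c e : raises 2 (quad q x c e).
Proof.
apply: raisesD; first by apply: raises_sum => i _; apply/raisesZ/raises_hop_bw.
apply: raises_sum => u _; apply: raises_sum => v _; apply: raises_sum => i _.
apply: raises_sum => j lt_ij; apply/raisesZ/raises_hop2.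
by rewrite -val_eqE neq_ltn lt_ij.
Qed.

Lemma raises_Gamma (k : 'I_3) z : separated q x -> admissible q x z ->
  raises k (Gamma q x k z).
Proof.
move=> sep adm; have [->|->|->] := ord3P k.
- by rewrite [Gamma _ _ _ _]Gamma0E; apply: raises_diagop.
- rewrite [Gamma _ _ _ _]Gamma1E // -[nat_of_ord 1]/(1 + 0)%N.
  exact: raisesM (raises_lin _) (raises_diagop _).
rewrite [Gamma _ _ _ _]Gamma2E // -[nat_of_ord 2]/(2 + 0)%N.
exact: raisesM (raises_quad _ _) (raises_diagop _).
Qed.

(** Preserving the weight means commuting with the projections [pr m] onto the weight spaces, and
    this passes to the inverse. *)
Lemma raises_inv (T T' : op) : T * T' = 1 -> raises 0 T -> raises 0 T'.
Proof.
move=> TT' hT; have T'T : T' * T = 1 by apply: mulmx1C.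
pose pr m : op := mkop (fun s t => ((s == t) && (weight s == m))%:R).
have prl m A s t : ent (pr m * A) s t = ent A s t *+ (weight s == m).
  rewrite entM (bigD1 s) //= mkopE eqxx big1 ?addr0 /= => [|u ne_us].
    by case: eqP; rewrite ?mul1r ?mul0r.
  by rewrite mkopE eq_sym (negbTE ne_us) mul0r.
have prr m A s t : ent (A * pr m) s t = ent A s t *+ (weight t == m).
  rewrite entM (bigD1 t) //= mkopE eqxx big1 ?addr0 /= => [|u ne_ut].
    by case: eqP; rewrite ?mulr1 ?mulr0.
  by rewrite mkopE (negbTE ne_ut) mulr0.
have comm m : T * pr m = pr m * T.
  apply: opP => s t; rewrite prl prr.
  have [->//|ne] := eqVneq (weight s) (weight t).
  by rewrite hT ?addn0 // !mul0rn.
have comm' m : T' * pr m = pr m * T'.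
  by rewrite -[LHS]mulr1 -TT' -!mulrA [pr m * _]mulrA -comm !mulrA T'T mul1r.
move=> s t; rewrite addn0 => ne_st.
have := congr1 (fun A => ent A s t) (comm' (weight t)).
by rewrite prl prr eqxx (negbTE ne_st).
Qed.

End Grading.

Lemma weight_split N (s : state N.+1) : weight s = (weight (sinit s) + s ord_max)%N.
Proof.
rewrite /weight big_ord_recr /=; congr (_ + _)%N.
by apply: eq_bigr => i _; rewrite ffunE.
Qed.

(** Nothing enters the column from below, so by conservation the left edges carry exactly [k] more
    than the right edges. *)
Lemma raises_colop (F : fieldType) (q : F) N (x : 'I_N -> F) (k : 'I_3) z :
  raises k (colop q x k z).
Proof.
elim: N x k => [|N IH] x k s t.
  rewrite /weight !big_ord0 mkopE big_ord0 mxE add0n.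
  by case: (0 =P k) => // <-.
rewrite colop_blk mkopE ent_sum !weight_split => st; apply: big1 => j _.
rewrite entZ.
have [E1|/ikW_conserve->] := eqVneq (j + s ord_max)%N (k + t ord_max)%N;
  last by rewrite mul0r.
rewrite IH ?mulr0 //; apply: contra st => /eqP->.
by rewrite -addnA E1 addnCA addnC.
Qed.

(** * Commutators with the diagonal column operator *)

Section Commutator.
Variables (F : fieldType) (q : F) (N : nat) (x : 'I_N -> F) (z v : F).
Hypotheses (sep : separated q x) (admz : admissible q x z) (admv : admissible q x v).
Hypotheses (vz : v - z != 0) (vz2 : v - q ^+ 2 * z != 0) (vz3 : v - q ^+ 3 * z != 0).
Notation W := (ikW q v z).

(* The ratio W(0,2;2,0) / W(0,2;1,1), which eliminates C_2(v) C_0(z) between the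
   exchange relations (2,0) and (1,1); C_0(v) C_2(z) is then left with
   coefficient 1. *)
Definition commutator_coef : F :=
  (v + q ^+ 2 * v - q ^+ 2 * z - q ^+ 3 * z) / (q * (1 - q) * (v - z)).

(** Checked on coefficients without the exchange relations for [Gamma2]. The conjugated columns obey
    the same relation as a consequence of their exchange relations, and the comparison identifies
    the two. *)
Lemma Gamma2_commutator : Gamma2 q x z * Gamma0 q x v =
  Gamma0 q x v * Gamma2 q x z
  + (W 1 1 2 0 - commutator_coef * W 1 1 1 1) *: (Gamma1 q x v * Gamma1 q x z)
  + commutator_coef *: (Gamma1 q x z * Gamma1 q x v).
Proof.
rewrite !Gamma2E // !Gamma1E // !Gamma0E.
rewrite [gam0 q x v * (_ * _)]mulrA (diag_quad _ _ (dsite_ratio admv)).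
have lg z1 z2 : admissible q x z1 ->
  lin q x (jcoef q x z1) * gam0 q x z1 * (lin q x (jcoef q x z2) * gam0 q x z2)
   = lin q x (jcoef q x z1) * lin q x (fun u i => dratio q x z1 u i * jcoef q x z2 u i)
     * (gam0 q x z1 * gam0 q x z2).
  move=> adm1; rewrite -!mulrA; congr (_ * _).
  by rewrite mulrA (diag_lin _ (dsite_ratio adm1)) -!mulrA.
rewrite !lg // !(lin_mul sep) -!mulrA [gam0 q x v * gam0 q x z]diagopC.
rewrite -!opZMl !quadZ -!mulrDl !quadD; congr (_ * _).
have [q1 q2 q0 sx] := sep; have [z0 xz] := admz; have [v0 xv] := admv.
have q21 := one_sub_sqr_neq0 q2 q1.
apply: eq_quad => [u u' i j ne_ij|i].
  have ne_ji : j != i by rewrite eq_sym.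
  have [y1 y2] := sx _ _ ne_ij; have [y3 y4] := sx _ _ ne_ji.
  have y5 := sep_qsub sep ne_ij; have y6 := sep_qsub sep ne_ji.
  have [a1 a2] := xz i; have [a3 a4] := xz j; have [a5 a6] := xv i; have [a7 a8] := xv j.
  case: u u' => [] []; rewrite /commutator_coef /kcoef /paircoef /cross /dratio /jcoef
    /jsite /ikW /dsite /dsite_dot /tri /=; field;
    by rewrite ?y1 ?y2 ?y3 ?y4 ?y5 ?y6 ?a1 ?a2 ?a3 ?a4 ?a5 ?a6 ?a7 ?a8 ?q0 ?q1 ?q2 ?q21
      ?z0 ?v0 ?vz ?vz2 ?vz3.
have [a1 a2] := xz i; have [a5 a6] := xv i.
by rewrite /commutator_coef /bwcoef /dratio /jcoef /jsite /ikW /dsite /dsite_dot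
  /tri /=; field;
  rewrite ?a1 ?a2 ?a5 ?a6 ?q0 ?q1 ?q2 ?q21 ?z0 ?v0 ?vz ?vz2 ?vz3.
Qed.

End Commutator.

(** * The joint spectrum of the diagonal column operators *)

Section Spectrum.
Variables (F : fieldType) (q : F) (N : nat) (x : 'I_N -> F).

(** The added conditions make each [x j] admissible as a column parameter for the other sites. *)
Definition strongly_separated := [/\ separated q x, forall i, x i != 0 &
  forall i j, i != j -> (x i - q ^+ 2 * x j != 0) /\ (x i - q ^+ 3 * x j != 0)].

Hypothesis F_infinite : forall p : {poly F}, p != 0 -> exists v, ~~ root p v.
Hypothesis sep : strongly_separated.

Let num (y v : F) : 'I_3 -> F := tri 1 (y - v) ((y - v) * (y - q * v)).
Let den (y v : F) : 'I_3 -> F :=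
  tri 1 (y - q ^+ 2 * v) ((y - q ^+ 2 * v) * (y - q ^+ 3 * v)).

Let pfac (c : F) (y : F) : {poly F} := y%:P - c *: 'X.
Let pfacE c y v : (pfac c y).[v] = y - c * v.
Proof. by rewrite !hornerE. Qed.

Let nump y (a : 'I_3) : {poly F} := nth 0 [:: 1; pfac 1 y; pfac 1 y * pfac q y] a.
Let denp y (a : 'I_3) : {poly F} :=
  nth 0 [:: 1; pfac (q ^+ 2) y; pfac (q ^+ 2) y * pfac (q ^+ 3) y] a.

Let numpE y v a : (nump y a).[v] = num y v a.
Proof.
by have [->|->|->] := ord3P a; rewrite /nump /num /tri /= ?hornerM ?pfacE ?hornerC ?mul1r.
Qed.

Let denpE y v a : (denp y a).[v] = den y v a.
Proof.
by have [->|->|->] := ord3P a; rewrite /denp /den /tri /= ?hornerM ?pfacE ?hornerC.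
Qed.

(** The difference of the eigenvalues of [Gamma0] on [s] and [t], cleared of denominators, as a
    polynomial in the column parameter. *)
Let gap (s t : state N) : {poly F} :=
  (\prod_i nump (x i) (s i)) * (\prod_i denp (x i) (t i))
  - (\prod_i nump (x i) (t i)) * (\prod_i denp (x i) (s i)).

Let gapE s t v : (gap s t).[v] =
  (\prod_i num (x i) v (s i)) * (\prod_i den (x i) v (t i))
  - (\prod_i num (x i) v (t i)) * (\prod_i den (x i) v (s i)).
Proof.
rewrite /gap hornerD hornerN !hornerM !horner_prod.
by congr (_ * _ - _ * _); apply: eq_bigr => i _; rewrite ?numpE ?denpE.
Qed.

Let gapC s t : gap s t = - gap t s.
Proof. by rewrite /gap opprB. Qed.

(* The eigenvalue on [t] vanishes at [v = x_i] if [t i = 1] and at [v = x_i / q]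
   if [t i = 2], while the one on [s] does not. *)
Let gap_neq0 (s t : state N) i : (s i < t i)%N -> gap s t != 0.
Proof.
have [sep1 x0 sx'] := sep; have [q1 q2 q0 sx] := sep1.
have q21 := one_sub_sqr_neq0 q2 q1.
move=> lt_st.
suff [v [num_t num_s den_t]] : exists v, [/\ num (x i) v (t i) = 0,
    forall j, num (x j) v (s j) != 0 & forall j, den (x j) v (t j) != 0].
  apply/eqP => /(congr1 (horner^~ v)); rewrite /= gapE horner0.
  rewrite [X in _ - X * _](bigD1 i) //= num_t !mul0r subr0.
  by apply/eqP/mulf_neq0; apply/prodf_neq0 => j _.
have own (a b : F) : a != 0 -> x i * a = b -> b != 0 by move=> a0 <-; rewrite mulf_neq0.
have [ti1|ti2] : t i = 1 \/ t i = 2.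
  by have [ti|->|->] := ord3P (t i); [rewrite ti in lt_st|left|right].
- have si0 : s i = 0 by have [//|si|si] := ord3P (s i); rewrite ti1 si in lt_st.
  exists (x i); split=> [|j|j]; first by rewrite ti1 /num /tri /= subrr.
    have [->|ne_ji] := eqVneq j i; first by rewrite si0 /num /tri /= oner_eq0.
    have [y1 y2] := sx _ _ ne_ji.
    by have [->|->|->] := ord3P (s j); rewrite /num /tri /= ?oner_eq0 ?mulf_neq0.
  have [->|ne_ji] := eqVneq j i.
    by rewrite ti1 /den /tri /=; apply: (own _ _ q21); ring.
  have [y1 y2] := sx' _ _ ne_ji.
  by have [->|->|->] := ord3P (t j); rewrite /den /tri /= ?oner_eq0 ?mulf_neq0.
have qv : q * (x i / q) = x i by rewrite mulrC divfK.
have qv2 : q ^+ 2 * (x i / q) = q * x i by rewrite expr2 -mulrA qv.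
have qv3 : q ^+ 3 * (x i / q) = q ^+ 2 * x i by rewrite exprS -mulrA qv2 expr2 mulrA.
have div_sub y : q * y - x i != 0 -> y - x i / q != 0.
  by apply: contra => /eqP/subr0_eq->; rewrite qv subrr.
have own1 : x i - q * x i != 0 by apply: (own _ _ q2); ring.
exists (x i / q); split=> [|j|j].
- by rewrite ti2 /num /tri /= qv subrr mulr0.
- have [->|ne_ji] := eqVneq j i.
    have [->|->|si] := ord3P (s i); rewrite /num /tri /= ?oner_eq0 //.
      by apply: div_sub; rewrite -oppr_eq0 opprB.
    by rewrite si ti2 in lt_st.
  have [y1 y2] := sx _ _ ne_ji; have y3 := div_sub _ (sep_qsub sep1 ne_ji).
  by have [->|->|->] := ord3P (s j); rewrite /num /tri /= ?oner_eq0 ?qv ?mulf_neq0.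
have [->|ne_ji] := eqVneq j i.
  rewrite ti2 /den /tri /= qv2 qv3 mulf_neq0 //.
  by apply: (own _ _ q21); ring.
have [_ y2] := sx _ _ ne_ji; have [y3 _] := sx' _ _ ne_ji.
by have [->|->|->] := ord3P (t j); rewrite /den /tri /= ?oner_eq0 ?qv2 ?qv3 ?mulf_neq0.
Qed.

Lemma gam0_separates (s t : state N) (z : F) : s != t -> z != 0 ->
  exists v, [/\ admissible q x v, v - z != 0, v - q ^+ 2 * z != 0,
    v - q ^+ 3 * z != 0 & ent (Gamma0 q x v) s s != ent (Gamma0 q x v) t t].
Proof.
move=> ne_st z0; have [sep1 x0 _] := sep; have [_ _ q0 _] := sep1.
have gap0 : gap s t != 0.
  have /existsP[i ne_i] : [exists i, s i != t i].
    rewrite -negb_forall; apply: contra ne_st => /forallP st.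
    by apply/eqP/ffunP => i; apply/eqP.
  move: ne_i; rewrite -val_eqE neq_ltn => /orP[|/gap_neq0]; first exact: gap_neq0.
  by rewrite gapC oppr_eq0.
have pfac0 c y : y != 0 -> pfac c y != 0.
  apply: contra => /eqP/(congr1 (horner^~ 0)).
  by rewrite /= pfacE horner0 mulr0 subr0 => ->.
(* A point outside the roots of this product separates the eigenvalues and avoids 0, [z], [q^2 z],
   [q^3 z] and the poles at the sites. The linear factors are nonzero because their constant terms
   are [z] or [x i]. *)
have [|v] := F_infinite (p := gap s t * 'X * pfac 1 z
    * (pfac (q ^- 2) z * pfac (q ^- 3) z)
    * (\prod_i (pfac (q ^+ 2) (x i) * pfac (q ^+ 3) (x i)))).
  rewrite !mulf_neq0 ?polyX_eq0 ?pfac0 //; apply/prodf_neq0 => i _.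
  by rewrite mulf_neq0 ?pfac0.
rewrite /root !hornerM !mulf_eq0 !negb_or horner_prod hornerX !pfacE mul1r.
move=> /andP[/andP[/andP[/andP[gap_v v0] vz] /andP[vz2 vz3]] /prodf_neq0 xv].
have qn m : z - q ^- m * v != 0 -> v - q ^+ m * z != 0.
  apply: contra => /eqP/subr0_eq->; rewrite mulrA mulVf ?mul1r ?subrr //.
  by rewrite expf_neq0.
have adm : admissible q x v.
  by split=> // i; have := xv i isT; rewrite hornerM !pfacE mulf_eq0 negb_or => /andP[].
exists v; split; [by []|by rewrite -oppr_eq0 opprB|exact: qn|exact: qn|].
apply: contra gap_v; rewrite Gamma0E !diagopE !eqxx !mulr1n => /eqP E.
have dsiteE y a : dsite q y v a = num y v a / den y v a.
  by have [->|->|->] := ord3P a; rewrite /dsite /num /den /tri /= ?divr1.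
move: E; under eq_bigr do rewrite dsiteE; under [RHS]eq_bigr do rewrite dsiteE.
rewrite !big_split /= !prodfV => /eqP.
have den0 (u : state N) : \prod_i den (x i) v (u i) != 0.
  apply/prodf_neq0 => i _; have [_ /(_ i)[x2 x3]] := adm.
  by have [->|->|->] := ord3P (u i); rewrite /den /tri /= ?oner_eq0 ?mulf_neq0.
by rewrite eqr_div // gapE subr_eq0.
Qed.

End Spectrum.

(** * The intertwiner *)

Section Intertwiner.
Variables (F : fieldType) (q : F).
Hypothesis F_infinite : forall p : {poly F}, p != 0 -> exists v, ~~ root p v.

Section Conjugation.
Variables (N : nat) (x : 'I_N -> F) (T T' : tensor_op F N).
Hypotheses (TT' : T * T' = 1).

Definition conj_col (k : 'I_3) (z : F) := T * colop q x k z * T'.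

Let T'T : T' * T = 1. Proof. exact: mulmx1C. Qed.

Lemma conj_col_exchange (k b : 'I_3) z v :
    admissible q x z -> admissible q x v ->
    v - q ^+ 2 * z != 0 -> v - q ^+ 3 * z != 0 ->
  conj_col k z * conj_col b v =
  \sum_(b' < 3) \sum_(j < 3) ikW q v z j b' k b *: (conj_col b' v * conj_col j z).
Proof.
move=> admz admv vz2 vz3.
have cM k1 k2 z1 z2 : conj_col k1 z1 * conj_col k2 z2
    = T * (colop q x k1 z1 * colop q x k2 z2) * T'.
  by rewrite /conj_col -!mulrA [T' * (T * _)]mulrA T'T mul1r.
rewrite cM colop_exchange // mulr_sumr mulr_suml; apply: eq_bigr => b' _.
rewrite mulr_sumr mulr_suml; apply: eq_bigr => j _.
by rewrite cM opZMr opZMl.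
Qed.

Lemma conj_colE k z A : T * colop q x k z = A * T -> conj_col k z = A.
Proof. by rewrite /conj_col => ->; rewrite -mulrA TT' mulr1. Qed.

Lemma conj_col_intertwines k z : T * colop q x k z = conj_col k z * T.
Proof. by rewrite -!mulrA T'T mulr1. Qed.

Hypotheses (sep : strongly_separated q x) (T_raises : raises 0 T).
Hypothesis T01 : forall z, admissible q x z ->
  T * colop q x 0 z = Gamma0 q x z * T /\ T * colop q x 1 z = Gamma1 q x z * T.

(* [X(z) - Gamma_2(z)] commutes with every [Gamma_0(v)], so it is diagonal, and
   it raises the weight by 2. *)
Lemma conj_col2 z : admissible q x z -> conj_col 2 z = Gamma2 q x z.
Proof.
move=> admz; have [sep1 _ _] := sep; have [q1 q2 q0 _] := sep1.
have [z0 _] := admz; apply: opP => s t.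
(* On the diagonal both entries vanish, since both operators raise the weight by 2. *)
have [<-|ne_st] := eqVneq s t.
  have r2 : raises (0 + 2 + 0)%N (conj_col 2 z).
    apply: raisesM (raises_inv TT' T_raises).
    exact: raisesM T_raises (@raises_colop _ q _ x 2 z).
  rewrite r2 ?[RHS](raises_Gamma (k := 2) sep1 admz) //;
    by rewrite -[X in X != _]addn0 eqn_add2l.
have [v [admv vz vz2 vz3 gap]] := gam0_separates F_infinite sep ne_st z0.
have G0 u : admissible q x u -> conj_col 0 u = Gamma0 q x u.
  by move=> admu; apply: conj_colE; case: (T01 admu).
have G1 u : admissible q x u -> conj_col 1 u = Gamma1 q x u.
  by move=> admu; apply: conj_colE; case: (T01 admu).
(* Relations (1, 1) and (2, 0) together eliminate [conj_col 2 v] and leave a formula for the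
   commutator of [conj_col 2 z] with [Gamma0 v]. *)
have /(congr1 (fun A => ent A s t)) e11 := conj_col_exchange 1 1 admz admv vz2 vz3.
have /(congr1 (fun A => ent A s t)) e20 := conj_col_exchange 2 0 admz admv vz2 vz3.
have /(congr1 (fun A => ent A s t)) eG := Gamma2_commutator sep1 admz admv vz vz2 vz3.
have mulG0 A : ent (A * Gamma0 q x v) s t = ent A s t * ent (Gamma0 q x v) t t.
  rewrite entM (bigD1 t) //= big1 ?addr0 // => u ne_ut.
  by rewrite Gamma0E diagopE (negbTE ne_ut) mulr0.
have G0mul A : ent (Gamma0 q x v * A) s t = ent (Gamma0 q x v) s s * ent A s t.
  rewrite entM (bigD1 s) //= big1 ?addr0 // => u ne_us.
  by rewrite Gamma0E diagopE eq_sym (negbTE ne_us) mul0r.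
move: e11 e20 eG gap mulG0 G0mul.
rewrite !big_ord3 !(G0 z admz) !(G1 z admz) !(G0 v admv) !(G1 v admv) /commutator_coef.
(* The columns are generalized so that [entD] does not unfold them. *)
move: (Gamma0 q x z) (Gamma1 q x z) (Gamma2 q x z) (conj_col 2 z)
  (Gamma0 q x v) (Gamma1 q x v) (conj_col 2 v) => G0z G1z G2z Xz G0v G1v Xv.
rewrite /ikW /= !scale0r !(addr0, add0r) !(entD, entZ).
move=> ea eX eG gap mulG0 G0mul; move: ea eX eG; rewrite !mulG0 !G0mul.
set gs := ent G0v s s in gap *; set gt := ent G0v t t in gap *.
set X := ent Xz s t; set G := ent G2z s t => ea eX eG.
apply/eqP; rewrite -subr_eq0.
have gap' : gs - gt != 0 by rewrite subr_eq0.
suff : (X - G) * (gs - gt) == 0 by rewrite mulf_eq0 (negbTE gap') orbF.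
(* Both brackets are entries of commutators with [Gamma0 v], up to the same sign, and the two
   commutators agree. *)
have -> : (X - G) * (gs - gt) = (G * gt - gs * G) - (X * gt - gs * X) by ring.
rewrite eX eG ea; apply/eqP. field.
by rewrite q0 q2 vz vz2 vz3.
Qed.
End Conjugation.

Lemma strongly_separated_wid N (x : 'I_N.+1 -> F) : strongly_separated q x ->
  strongly_separated q (fun i => x (wid i)).
Proof.
case=> -[q1 q2 q0 sx] x0 sx'.
have ne_wid (i j : 'I_N) : i != j -> wid i != wid j.
  by apply: contra => /eqP/wid_inj->.
by split=> [|//|i j /ne_wid]; [split=> // i j /ne_wid; apply: sx|apply: sx'].
Qed.

Lemma prodop_inv N (f : 'I_N -> 'I_3 -> F) : (forall i a, f i a != 0) ->
  diagop f * diagop (fun i a => (f i a)^-1) = 1.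
Proof.
move=> f0; rewrite diagopM -prodop1; apply: eq_prodop => i.
by apply/matrixP => a b; rewrite dgmE mxE divff.
Qed.

Lemma raises_blk N (X : 'I_3 -> 'I_3 -> tensor_op F N) :
  (forall (a b : 'I_3), (a <= b)%N -> raises (b - a) (X a b)) ->
  (forall (a b : 'I_3), (b < a)%N -> X a b = 0) -> raises 0 (blk X).
Proof.
move=> hX X0 s t; rewrite addn0 !weight_split mkopE => ne_st.
have [le_st|lt_ts] := leqP (s ord_max) (t ord_max); last by rewrite X0 // ent0.
rewrite hX //; apply: contra ne_st => /eqP->.
by rewrite -addnA subnK.
Qed.

(** Back substitution from the inverses [D a] of the diagonal blocks. *)
Lemma blk_upper_inv N (X : 'I_3 -> 'I_3 -> tensor_op F N) (D : 'I_3 -> tensor_op F N) :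
  (forall (a b : 'I_3), (b < a)%N -> X a b = 0) -> (forall a, X a a * D a = 1) ->
  exists Y, blk X * Y = 1.
Proof.
move=> X0 XD.
exists (blk (fun a b => match val a, val b with
  | 0%N, 0%N => D 0 | 1%N, 1%N => D 1 | 2%N, 2%N => D 2
  | 0%N, 1%N => - (D 0 * X 0 1 * D 1)
  | 1%N, 2%N => - (D 1 * X 1 2 * D 2)
  | 0%N, 2%N => D 0 * (X 0 1 * D 1 * X 1 2 - X 0 2) * D 2
  | _, _ => 0 end)).
rewrite blkM -blk1; apply: eq_blk => a b; rewrite big_ord3.
have [->|->|->] := ord3P a; have [->|->|->] := ord3P b;
  rewrite /= ?(X0 1 0, X0 2 0, X0 2 1) ?(mul0r, mulr0, add0r, addr0) ?XD //.
- by rewrite mulrN !mulrA XD mul1r addNr.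
- rewrite !mulrA XD mul1r mulrN !mulrA mulrBl.
  by rewrite -addrA [- _ + _]addrC addrA subrK subrr.
- by rewrite mulrN !mulrA XD mul1r addNr.
Qed.

Lemma intertwiner N (x : 'I_N -> F) : strongly_separated q x ->
  exists T T' : tensor_op F N, [/\ T * T' = 1, raises 0 T,
    forall k z, admissible q x z -> T * colop q x k z = Gamma q x k z * T,
    forall t, ent T [ffun=> 2] t = (t == [ffun=> 2])%:R &
    forall s, ent T s [ffun=> 0] = (s == [ffun=> 0])%:R].
Proof.
elim: N x => [|N IH] x sep.
  exists 1, 1; split=> [||k z adm|t|s]; rewrite ?mulr1 ?mul1r ?ent1 1?eq_sym //.
    exact: raises1.
  apply: opP => s t; have -> : s = t by apply/ffunP => -[].
  have [->|->|->] := ord3P k; rewrite mkopE big_ord0.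
  - by rewrite [Gamma _ _ _ _]Gamma0E diagopE big_ord0 eqxx mxE.
  - by rewrite mxE /= ent_sum big1 // => u _; rewrite big_ord0 ent0.
  - rewrite mxE /= entD big_ord0 ent0 add0r ent_sum big1 // => u _.
    by rewrite ent_sum big1 // => v _; rewrite big_ord0 ent0.
set y := fun i => x (wid i); set w := x ord_max.
have [sep1 x0 sx'] := sep; have [q1 q2 q0 sx] := sep1.
have sepy : strongly_separated q y := strongly_separated_wid sep.
have [sepy1 _ _] := sepy.
have [T [T' [TT' hT TC T2 T0]]] := IH _ sepy.
have yw i : [/\ y i - w != 0, y i - q * w != 0, y i - q ^+ 2 * w != 0,
    y i - q ^+ 3 * w != 0 & q * y i - w != 0].
  have ne := wid_max i; have [? ?] := sx _ _ ne; have [? ?] := sx' _ _ ne.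
  by split=> //; apply: (sep_qsub sep1 ne).
have admw : admissible q y w by split=> [|i]; [apply: x0|case: (yw i)].
have yw1 i : (y i - w != 0) /\ (y i - q * w != 0) by case: (yw i).
have yw2 i : q * y i - w != 0 by case: (yw i).
(* Here [blk D] is [T] on the first [N] sites and the identity on the last. *)
pose P := twist q x; pose D (a b : 'I_3) := if a == b then T else 0.
have P0 (a b : 'I_3) : (b < a)%N -> P a b = 0.
  by have [->|->|->] := ord3P a; have [->|->|->] := ord3P b.
have [Y PY] : exists Y, blk P * Y = 1.
  pose E (a : 'I_3) := match val a with
    | 0%N => diagop (fun i a => (dsite q (y i) w a)^-1)
    | 1%N => diagop (fun i a => (twist_site q y w i a)^-1) | _ => 1 end.
  apply: (@blk_upper_inv N P E P0) => a.
  have [->|->|->] := ord3P a; rewrite /P /twist /E /= ?mulr1 //.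
    rewrite [Gamma _ _ _ _]Gamma0E; apply: prodop_inv => i b.
    have [? ? ? ? ?] := yw i; have [->|->|->] := ord3P b;
      by rewrite /dsite /tri /= ?oner_eq0 ?mulf_neq0 ?invr_eq0 ?mulf_neq0.
  apply: prodop_inv => i b; have [? ? ? ? ?] := yw i.
  have [->|->|->] := ord3P b;
    by rewrite /twist_site /tri /= ?oner_eq0 ?mulf_neq0 ?invr_eq0 ?mulf_neq0.
have DD : blk D * blk (fun a b : 'I_3 => if a == b then T' else 0) = 1.
  rewrite blkM -blk1; apply: eq_blk => a b; rewrite (bigD1 a) //= big1 => [|c ne_ca].
    by rewrite /D eqxx; case: eqP; rewrite ?TT' ?mulr0 ?addr0.
  by rewrite /D eq_sym (negbTE ne_ca) mul0r.
have hPD : raises 0 (blk P * blk D).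
  rewrite -[0%N]/(0 + 0)%N; apply: raisesM.
    apply: raises_blk P0 => a b.
    have [->|->|->] := ord3P a; have [->|->|->] := ord3P b => // _;
      rewrite ?subn0 ?subnn; do ?exact: raises_Gamma.
    - exact: raises_diagop.
    - rewrite -[(2%R - 1%R)%N]/(1 + 0)%N.
      exact: raisesM (raises_lin _ _ _) (raises_diagop _).
    - exact: raises1.
  apply: raises_blk => a b; rewrite /D; have [->|_] := eqVneq a b => //.
  - by rewrite subnn.
  - by move=> _ s t _; rewrite ent0.
  - by rewrite ltnn.
(* Conjugation by [blk D] twists the part of the column below the top row and leaves the vertex at
   the last site alone. *)
have DC k z : admissible q y z ->
    blk D * colop q x k z = blk (column_block q x z k) * blk D.
  move=> adm; rewrite colop_blk !blkM; apply: eq_blk => a b.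
  rewrite [LHS](bigD1 a) //= [X in _ + X]big1 ?addr0 => [|c ne_ca]; last first.
    by rewrite /D eq_sym (negbTE ne_ca) mul0r.
  rewrite [RHS](bigD1 b) //= [X in _ = _ + X]big1 ?addr0 => [|c ne_cb]; last first.
    by rewrite /D (negbTE ne_cb) mulr0.
  rewrite /D !eqxx mulr_sumr mulr_suml; apply: eq_bigr => j _.
  by rewrite opZMr opZMl TC.
have TT1 : blk P * blk D * (blk (fun a b : 'I_3 => if a == b then T' else 0) * Y) = 1.
  by rewrite -mulrA [blk D * (_ * _)]mulrA DD mul1r.
have TC01 z : admissible q x z ->
    blk P * blk D * colop q x 0 z = Gamma0 q x z * (blk P * blk D) /\
    blk P * blk D * colop q x 1 z = Gamma1 q x z * (blk P * blk D).
  move=> adm; have [z0 xz] := adm; have [wz2 wz3] := xz ord_max.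
  have admz : admissible q y z by split=> // i; apply: xz.
  (* The exchange relations of the twisted columns on [N] sites are those of the untwisted ones,
     transported by [T]. *)
  have ex k b : Gamma q y k z * Gamma q y b w = \sum_(b' < 3) \sum_(j < 3)
      ikW q w z j b' k b *: (Gamma q y b' w * Gamma q y j z).
    have CE l u : admissible q y u -> conj_col y T T' l u = Gamma q y l u.
      by move=> admu; apply: conj_colE => //; apply: TC.
    rewrite -!CE // conj_col_exchange //; apply: eq_bigr => b' _.
    by apply: eq_bigr => j _; rewrite !CE.
  rewrite -!mulrA !DC // !mulrA; split; congr (_ * _).
    exact: twist_Gamma0.
  exact: twist_Gamma1.
exists (blk P * blk D), (blk (fun a b : 'I_3 => if a == b then T' else 0) * Y).
split=> // [k z adm|t|s].
- have [->|->|->] := ord3P k; [exact: (TC01 z adm).1|exact: (TC01 z adm).2|].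
  by rewrite (conj_col_intertwines x TT1) (conj_col2 TT1 sep hPD TC01 adm).
(* The last row of the twist is (0, 0, 1), so the bra is fixed because [T] fixes it. *)
- rewrite blkM mkopE ffunE big_ord3 /P /D /twist /= !mul0r !add0r mul1r.
  rewrite state_eqE [t ord_max == _]eq_sym ffunE.
  have -> : sinit [ffun=> 2] = [ffun=> 2] :> state N by apply/ffunP => i; rewrite !ffunE.
  by case: (2 == t ord_max); rewrite ?andbT ?andbF ?ent0.
(* In the first block column only [Gamma0 w] occurs, and it fixes the state with all sites 0. *)
rewrite blkM mkopE ffunE big_ord3 /D /= !mulr0 !addr0.
have -> : sinit [ffun=> 0] = [ffun=> 0] :> state N by apply/ffunP => i; rewrite !ffunE.
rewrite state_eqE ffunE.
have -> : sinit [ffun=> 0] = [ffun=> 0] :> state N by apply/ffunP => i; rewrite !ffunE.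
have [->|->|->] := ord3P (s ord_max); rewrite /P /twist /= ?mul0r ?ent0 ?andbF //.
rewrite entM (bigD1 [ffun=> 0]) //= big1 => [|u /negbTE ne_u];
  last by rewrite T0 ne_u mulr0.
rewrite T0 !eqxx mulr1 addr0 andbT [Gamma _ _ _ _]Gamma0E diagopE.
case: eqP => [->|//]; rewrite mulr1n; apply: big1 => i _.
by rewrite ffunE.
Qed.

End Intertwiner.

(** * Column expansion of the partition function *)

Section PathSums.
Variables (F : fieldType) (T : finType).

(** Paths are functions on all [L.+1] vertices with prescribed ends, which matches the edge matrices
    [h] and [v] of [F_S]. *)
Definition path_sum L (A : 'I_L -> T -> T -> F) (a b : T) : F :=
  \sum_(p : {ffun 'I_L.+1 -> T} | (p ord0 == a) && (p ord_max == b))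
    \prod_(c < L) A c (p (widen_ord (leqnSn L) c)) (p (lift ord0 c)).

Lemma path_sum0 (A : 'I_0 -> T -> T -> F) a b : path_sum A a b = (a == b)%:R.
Proof.
rewrite /path_sum; have [<-|ne_ab] := eqVneq a b.
  rewrite (big_pred1 [ffun=> a]) => [|p]; first by rewrite big_ord0.
  have -> : (ord_max : 'I_1) = ord0 by apply: val_inj.
  rewrite andbb; apply/eqP/eqP => [pa|->]; last by rewrite ffunE.
  by apply/ffunP => i; rewrite ffunE (ord1 i).
rewrite big_pred0 // => p; apply: contraNF ne_ab => /andP[/eqP <- /eqP <-].
by apply/eqP; congr (p _); apply: val_inj.
Qed.

Lemma path_sumS L (A : 'I_L.+1 -> T -> T -> F) a b :
  path_sum A a b = \sum_c path_sum (fun i => A (wid i)) a c * A ord_max c b.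
Proof.
have wid0 n : ord0 = wid (ord0 : 'I_n.+1) by apply: val_inj.
have widmax n : widen_ord (leqnSn n.+1) ord_max = wid (ord_max : 'I_n.+1).
  exact: val_inj.
have liftmax n : lift ord0 (ord_max : 'I_n.+1) = ord_max by apply: val_inj.
have sjoin_wid (p : {ffun 'I_L.+1 -> T}) e i : sjoin p e (wid i) = p i.
  by rewrite -[in RHS](sjoin_init p e) [in RHS]ffunE.
rewrite /path_sum big_mkcond sum_state (bigD1 b) //= [X in _ + X]big1 ?addr0; last first.
  by move=> e /negbTE ne_eb; rewrite big1 // => p _; rewrite sjoin_last ne_eb andbF.
under [RHS]eq_bigr do rewrite mulr_suml.
rewrite -big_mkcond /=.
rewrite (partition_big (fun p : {ffun 'I_L.+1 -> T} => p ord_max) predT) //=.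
apply: eq_bigr => c _; apply: eq_big => [p|p /andP[_ /eqP <-]].
  by rewrite sjoin_last eqxx andbT wid0 sjoin_wid.
rewrite big_ord_recr /= liftmax sjoin_last widmax sjoin_wid; congr (_ * _).
apply: eq_bigr => i _; rewrite -/(wid i) -[widen_ord _ (wid i)]/(wid (wid i)) sjoin_wid.
have -> : lift ord0 (wid i) = wid (lift ord0 i) by apply: val_inj.
by rewrite sjoin_wid.
Qed.

End PathSums.

Lemma mx_path_sum (F : fieldType) n L (M : 'I_L -> 'M[F]_n) a b :
  (\prod_(c < L) M c) a b = path_sum (fun c i j => M c i j) a b.
Proof.
elim: L M a b => [|L IH] M a b; first by rewrite big_ord0 path_sum0 mxE.
rewrite big_ord_recr /= path_sumS -mulmxE mxE; apply: eq_bigr => c _.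
by rewrite -IH.
Qed.

Lemma op_path_sum (F : fieldType) N L (A : 'I_L -> tensor_op F N) s t :
  ent (\prod_(c < L) A c) s t = path_sum (fun c s t => ent (A c) s t) s t.
Proof.
elim: L A s t => [|L IH] A s t; first by rewrite big_ord0 path_sum0 ent1.
rewrite big_ord_recr /= path_sumS entM; apply: eq_bigr => c _.
by rewrite -IH.
Qed.

Section ColumnExpansion.
Variables (F : fieldType) (N L : nat) (q : F) (S : nat -> 'I_3).
Variables (x : 'I_N -> F) (z : nat -> F).

(** A product of columns is a sum over paths of states, which are the columns of [h]. An entry of
    one column operator is a sum over vertical paths, and distributing the product over these sums
    assembles [v]. *)
Lemma F_S_columns : F_S L q S x z =
  ent (\prod_(c < L) colop q x (S c) (z c)) [ffun=> 2] [ffun=> 0].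
Proof.
rewrite op_path_sum /path_sum /F_S.
pose toH (p : {ffun 'I_L.+1 -> state N}) : 'M['I_3]_(N, L.+1) := \matrix_(r, c) p c r.
pose ofH (h : 'M['I_3]_(N, L.+1)) : {ffun 'I_L.+1 -> state N} :=
  [ffun c => [ffun r => h r c]].
rewrite (reindex toH) /=; last first.
  exists ofH => [p _|h _].
    by apply/ffunP => c; apply/ffunP => r; rewrite !ffunE mxE.
  by apply/matrixP => r c; rewrite mxE !ffunE.
apply: eq_big => [p|p _].
  apply/forallP/andP => [hp|[/eqP p0 /eqP pL] r].
    by split; apply/eqP/ffunP => r; have := hp r;
      rewrite !mxE ffunE => /andP[/eqP ? /eqP ?].
  by rewrite !mxE p0 pL !ffunE eqxx.
under [RHS]eq_bigr do rewrite mkopE mx_path_sum.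
rewrite bigA_distr_big_dep /=.
pose toV (f : {ffun 'I_L -> {ffun 'I_N.+1 -> 'I_3}}) : 'M['I_3]_(N.+1, L) :=
  \matrix_(r, c) f c r.
pose ofV (v : 'M['I_3]_(N.+1, L)) : {ffun 'I_L -> {ffun 'I_N.+1 -> 'I_3}} :=
  [ffun c => [ffun r => v r c]].
rewrite (reindex toV) /=; last first.
  exists ofV => [f _|v _].
    by apply/ffunP => c; apply/ffunP => r; rewrite !ffunE mxE.
  by apply/matrixP => r c; rewrite mxE !ffunE.
apply: eq_big => [f|f _].
  by apply/forallP/familyP => hf c; have := hf c; rewrite !mxE.
rewrite exchange_big; apply: eq_bigr => c _; apply: eq_bigr => r _.
by rewrite !mxE.
Qed.

End ColumnExpansion.

Lemma bra_ket_ent (F : fieldType) N (A : tensor_op F N) :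
  (bra_2N F N *m A *m ket_0N F N) 0 0 = ent A [ffun=> 2] [ffun=> 0].
Proof.
rewrite mxE reindex_rank (bigD1 [ffun=> 0]) //= [X in _ + X]big1 ?addr0 => [|s ne_s].
  rewrite mxE reindex_rank (bigD1 [ffun=> 2]) //= [X in _ + X]big1 ?addr0 => [|s ne_s].
    rewrite !mxE /state_at !enum_rankK !big1 ?mul1r ?mulr1 //.
    - by move=> i _; rewrite ffunE !mxE.
    - by move=> i _; rewrite ffunE !mxE.
  have /existsP[i ne_i] : [exists i, s i != 2].
    rewrite -negb_forall; apply: contra ne_s => /forallP s2.
    by apply/eqP/ffunP => i; rewrite ffunE; apply/eqP.
  rewrite mxE /state_at enum_rankK (bigD1 i) //= mxE (negbTE ne_i) andbF !mul0r //.
have /existsP[i ne_i] : [exists i, s i != 0].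
  rewrite -negb_forall; apply: contra ne_s => /forallP s2.
  by apply/eqP/ffunP => i; rewrite ffunE; apply/eqP.
rewrite [ket_0N _ _ _ _]mxE /state_at enum_rankK (bigD1 i) //=.
by rewrite [X in _ * (X * _)]mxE (negbTE ne_i) mul0r mulr0.
Qed.

(** * The identity for strongly separated parameters *)

Section GenericIdentity.
Variables (F : fieldType) (q : F) (N : nat) (x : 'I_N -> F) (z : nat -> F).
Hypothesis F_infinite : forall p : {poly F}, p != 0 -> exists v, ~~ root p v.
Hypothesis sep : strongly_separated q x.

Lemma F_S_Gamma L (S : nat -> 'I_3) : (forall c, admissible q x (z c)) ->
  F_S L q S x z = ent (\prod_(c < L) Gamma q x (S c) (z c)) [ffun=> 2] [ffun=> 0].
Proof.
move=> adm; have [T [T' [_ _ TC T2 T0]]] := intertwiner F_infinite sep.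
have TP : T * \prod_(c < L) colop q x (S c) (z c)
    = \prod_(c < L) Gamma q x (S c) (z c) * T.
  elim: L => [|L IH]; first by rewrite !big_ord0 mulr1 mul1r.
  by rewrite !big_ord_recr /= mulrA IH -!mulrA TC.
rewrite F_S_columns.
have /(congr1 (fun A => ent A [ffun=> 2] [ffun=> 0])) := TP.
rewrite !entM (bigD1 [ffun=> 2]) //= T2 eqxx mul1r [X in _ + X]big1 ?addr0; last first.
  by move=> u /negbTE ne_u; rewrite T2 ne_u mul0r.
rewrite (bigD1 [ffun=> 0]) //= T0 eqxx mulr1 [X in _ + X]big1 ?addr0 //.
by move=> u /negbTE ne_u; rewrite T0 ne_u mulr0.
Qed.

Lemma Gamma_prod_pad L d (S : nat -> 'I_3) s : (forall c, (L <= c)%N -> S c = 0) ->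
  ent (\prod_(c < L + d) Gamma q x (S c) (z c)) s [ffun=> 0] =
  ent (\prod_(c < L) Gamma q x (S c) (z c)) s [ffun=> 0].
Proof.
move=> S0; elim: d => [|d IH]; first by rewrite addn0.
rewrite addnS big_ord_recr /= S0 ?leq_addr // [Gamma _ _ 0 _]Gamma0E entM.
rewrite (bigD1 [ffun=> 0]) //= [X in _ + X]big1 ?addr0 => [|u /negbTE ne_u]; last first.
  by rewrite diagopE ne_u mulr0.
by rewrite IH diagopE eqxx [\prod_i dsite _ _ _ _]big1 ?mulr1 // => i _; rewrite ffunE.
Qed.

End GenericIdentity.

(** * Specialization of rational functions *)

Section Specialization.
Variable F : fieldType.
Notation K := {fraction {poly F}}.
Local Notation "p %:F" := (@tofrac {poly F} p) : ring_scope.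

(** Evaluation at 0 as a relation, since it is defined only for fractions with a denominator that
    does not vanish there. *)
Definition specializes (f : K) (a : F) := exists p d : {poly F},
  [/\ d.[0] != 0, f = p%:F / d%:F & a = p.[0] / d.[0]].

Let den_neq0 (d : {poly F}) : d.[0] != 0 -> d%:F != 0 :> K.
Proof. by rewrite tofrac_eq0; apply: contra => /eqP->; rewrite horner0. Qed.

Lemma specializes_poly (p : {poly F}) : specializes p%:F p.[0].
Proof. by exists p, 1; rewrite hornerC oner_eq0 tofrac1 !divr1. Qed.

Lemma specializes_const (a : F) : specializes (a%:P)%:F a.
Proof. by have := specializes_poly a%:P; rewrite hornerC. Qed.

Lemma specializes0 : specializes 0 0.
Proof. by have := specializes_poly 0; rewrite horner0 tofrac0. Qed.

Lemma specializes1 : specializes 1 1.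
Proof. by have := specializes_poly 1; rewrite hornerC tofrac1. Qed.

Lemma specializesD f g a b :
  specializes f a -> specializes g b -> specializes (f + g) (a + b).
Proof.
move=> [p [d [d0 -> ->]]] [r [e [e0 -> ->]]]; exists (p * e + r * d), (d * e).
rewrite hornerD !hornerM tofracD !tofracM !addf_div ?den_neq0 //.
by split=> //; rewrite mulf_neq0.
Qed.

Lemma specializesN f a : specializes f a -> specializes (- f) (- a).
Proof.
by move=> [p [d [d0 -> ->]]]; exists (- p), d; rewrite hornerN tofracN !mulNr.
Qed.

Lemma specializesM f g a b :
  specializes f a -> specializes g b -> specializes (f * g) (a * b).
Proof.
move=> [p [d [d0 -> ->]]] [r [e [e0 -> ->]]]; exists (p * r), (d * e).
rewrite !hornerM !tofracM !mulf_div.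
by split=> //; rewrite mulf_neq0.
Qed.

Lemma specializesV f a : a != 0 -> specializes f a -> specializes f^-1 a^-1.
Proof.
move=> a0 [p [d [d0 -> ea]]]; exists d, p; rewrite ea !invf_div; split=> //.
by apply: contra a0 => /eqP p0; rewrite ea p0 mul0r.
Qed.

Lemma specializesX f a n : specializes f a -> specializes (f ^+ n) (a ^+ n).
Proof.
move=> fa; elim: n => [|n IH]; first exact: specializes1.
by rewrite !exprS; apply: specializesM.
Qed.

Lemma specializes_uniq f a b : specializes f a -> specializes f b -> a = b.
Proof.
move=> [p [d [d0 -> ->]]] [r [e [e0 /eqP + ->]]].
rewrite eqr_div ?den_neq0 // -!tofracM tofrac_eq => /eqP pe.
by apply/eqP; rewrite eqr_div // -!hornerM pe.
Qed.

Lemma specializes_sum I (r : seq I) (P : pred I) (f : I -> K) (a : I -> F) :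
  (forall i, P i -> specializes (f i) (a i)) ->
  specializes (\sum_(i <- r | P i) f i) (\sum_(i <- r | P i) a i).
Proof.
by move=> fa; apply: (big_ind2 specializes) => //;
  [apply: specializes0|move=> *; apply: specializesD].
Qed.

Lemma specializes_prod I (r : seq I) (P : pred I) (f : I -> K) (a : I -> F) :
  (forall i, P i -> specializes (f i) (a i)) ->
  specializes (\prod_(i <- r | P i) f i) (\prod_(i <- r | P i) a i).
Proof.
by move=> fa; apply: (big_ind2 specializes) => //;
  [apply: specializes1|move=> *; apply: specializesM].
Qed.

(** The powers of the indeterminate are pairwise distinct, so one of the first [size p] of them is
    not a root. This covers a finite [F] as well. *)
Lemma fraction_infinite (p : {poly K}) : p != 0 -> exists v, ~~ root p v.
Proof.
move=> p0; pose rs := [seq ('X^m : {poly F})%:F | m <- iota 0 (size p)].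
have : ~~ all (root p) rs.
  apply/negP => /(max_poly_roots p0) rs_lt.
  suff /rs_lt : uniq rs by rewrite size_map size_iota ltnn.
  rewrite map_inj_uniq ?iota_uniq // => m n /eqP.
  rewrite tofrac_eq => /eqP/(congr1 (size \o val)).
  by rewrite /= !size_polyXn => -[].
by case/allPn => v _ pv; exists v.
Qed.

Section Matrices.

Definition mx_specializes m n (A : 'M[K]_(m, n)) (B : 'M[F]_(m, n)) :=
  forall i j, specializes (A i j) (B i j).

Lemma mx_specializesM n (A A' : 'M[K]_n) B B' :
  mx_specializes A B -> mx_specializes A' B' -> mx_specializes (A * A') (B * B').
Proof.
move=> AB AB' i j; rewrite -!mulmxE !mxE; apply: specializes_sum => k _.
exact: specializesM.
Qed.

Lemma mx_specializes1 n : mx_specializes (1 : 'M[K]_n) 1.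
Proof.
by move=> i j; rewrite !mxE; case: eqP => _; [apply: specializes1|apply: specializes0].
Qed.

Lemma mx_specializesD m n (A A' : 'M[K]_(m, n)) B B' :
  mx_specializes A B -> mx_specializes A' B' -> mx_specializes (A + A') (B + B').
Proof. by move=> AB AB' i j; rewrite !mxE; apply: specializesD. Qed.

Lemma mx_specializesZ m n c a (A : 'M[K]_(m, n)) B :
  specializes c a -> mx_specializes A B -> mx_specializes (c *: A) (a *: B).
Proof. by move=> ca AB i j; rewrite !mxE; apply: specializesM. Qed.

Lemma mx_specializes_sum m n I (r : seq I) (P : pred I) (A : I -> 'M[K]_(m, n)) B :
  (forall i, P i -> mx_specializes (A i) (B i)) ->
  mx_specializes (\sum_(i <- r | P i) A i) (\sum_(i <- r | P i) B i).
Proof.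
by move=> AB i j; rewrite !summxE; apply: specializes_sum => k Pk; apply: AB.
Qed.

Lemma mx_specializes_prod n I (r : seq I) (P : pred I) (A : I -> 'M[K]_n) B :
  (forall i, P i -> mx_specializes (A i) (B i)) ->
  mx_specializes (\prod_(i <- r | P i) A i) (\prod_(i <- r | P i) B i).
Proof.
by move=> AB; apply: (big_ind2 (@mx_specializes n n)) => //;
  [apply: mx_specializes1|move=> *; apply: mx_specializesM].
Qed.

Lemma mx_specializes_delta m n i j :
  mx_specializes (delta_mx i j : 'M[K]_(m, n)) (delta_mx i j).
Proof.
move=> a b; rewrite !mxE; case: andP => _; [exact: specializes1|exact: specializes0].
Qed.

Lemma mx_specializes_diag3 f0 f1 f2 a0 a1 a2 :
    specializes f0 a0 -> specializes f1 a1 -> specializes f2 a2 ->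
  mx_specializes (diag3 f0 f1 f2) (diag3 a0 a1 a2).
Proof.
move=> h0 h1 h2 i j; rewrite !mxE; case: eqP => _; last exact: specializes0.
by have [->|->|->] := ord3P i.
Qed.

Lemma mx_specializes_local N (i : 'I_N) A B :
  mx_specializes A B -> mx_specializes (local_op i A) (local_op i B).
Proof.
by move=> AB a b; rewrite !mxE; case: ifP => _; [apply: AB|apply: specializes0].
Qed.

End Matrices.
End Specialization.

Section SpecializeOperators.
Variables (F : fieldType) (N : nat).
Notation K := {fraction {poly F}}.
Variables (q : F) (x : 'I_N -> F) (qK : K) (xK : 'I_N -> K).
Hypotheses (qs : specializes qK q) (xs : forall i, specializes (xK i) (x i)).
Hypotheses (q0 : q != 0) (q1 : 1 - q != 0) (q2 : 1 + q != 0).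
Hypothesis sep : forall i j, i != j -> (x i - x j != 0) /\ (x i - q * x j != 0).

Let q3 : 1 - q ^+ 2 != 0.
Proof. exact: one_sub_sqr_neq0. Qed.

Variables (z : F) (zK : K).
Hypotheses (zs : specializes zK z) (z0 : z != 0).
Hypothesis xz : forall i, (x i - q ^+ 2 * z != 0) /\ (x i - q ^+ 3 * z != 0).

Let xz2 i : x i - q ^+ 2 * z != 0. Proof. exact: (xz i).1. Qed.
Let xz3 i : x i - q ^+ 3 * z != 0. Proof. exact: (xz i).2. Qed.

(** Descends through a rational expression and leaves as goals the nonvanishing of the values that
    are inverted. *)
Ltac spec_arith :=
  match goal with
  | |- specializes 0 _ => apply: specializes0
  | |- specializes 1 _ => apply: specializes1
  | |- specializes (_ + _) _ => apply: specializesD; spec_arith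
  | |- specializes (- _) _ => apply: specializesN; spec_arith
  | |- specializes (_ * _) _ => apply: specializesM; spec_arith
  | |- specializes (_ ^-1) _ => apply: specializesV; [|spec_arith]
  | |- specializes (_ ^+ _) _ => apply: specializesX; spec_arith
  | _ => by []
  end.

Lemma specializes_ikW r i j k l :
  specializes (ikW qK (xK r) zK i j k l) (ikW q (x r) z i j k l).
Proof.
rewrite /ikW.
case: i => [|[|[|i]]]; case: j => [|[|[|j]]]; case: k => [|[|[|k]]];
  case: l => [|[|[|l]]]; spec_arith; rewrite ?mulf_neq0 ?xz2 ?xz3 //.
Qed.

Let sep1 i j : i != j -> x i - x j != 0. Proof. by move/sep => []. Qed.
Let sep2 i j : i != j -> x i - q * x j != 0. Proof. by move/sep => []. Qed.
Let sep3 i j : i != j -> q * x i - x j != 0.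
Proof. by rewrite eq_sym -oppr_eq0 opprB; apply: sep2. Qed.

Lemma specializes_d i : mx_specializes (d_ qK xK i zK) (d_ q x i z).
Proof.
apply: mx_specializes_local; apply: mx_specializes_diag3; spec_arith;
  by rewrite ?mulf_neq0 ?xz2 ?xz3.
Qed.

Lemma specializes_d_dot u i j : i != j ->
  mx_specializes (d_dot qK xK u i (xK j)) (d_dot q x u i (x j)).
Proof.
move=> ne_ij; case: u; apply: mx_specializes_local; apply: mx_specializes_diag3;
  spec_arith; by rewrite ?mulf_neq0 ?sep1 ?sep2 ?sep3.
Qed.

Lemma specializes_d_bw i j : i != j ->
  mx_specializes (d_bw qK xK i (xK j)) (d_bw q x i (x j)).
Proof.
move=> ne_ij; apply: mx_specializes_local; apply: mx_specializes_diag3;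
  spec_arith; by rewrite ?mulf_neq0 ?sep1 ?sep2 ?sep3.
Qed.

Let e_specializes (i : 'I_N) a b (cK : K) (c : F) : specializes cK c ->
  mx_specializes (cK *: local_op i (delta_mx a b)) (c *: local_op i (delta_mx a b)).
Proof. by move=> cc; apply/mx_specializesZ/mx_specializes_local/mx_specializes_delta. Qed.

Lemma specializes_e_dot u i : mx_specializes (e_dot qK xK u i zK) (e_dot q x u i z).
Proof.
by case: u; apply: e_specializes; spec_arith; rewrite ?mulf_neq0 ?xz2 ?xz3.
Qed.

Lemma specializes_e_dot2 u v i j : i != j ->
  mx_specializes (e_dot2 qK xK u v i j zK) (e_dot2 q x u v i j z).
Proof.
move=> ne_ij; have ne_ji : j != i by rewrite eq_sym.
case: u v => [] [];
  (apply: mx_specializesZ;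
    [spec_arith; by rewrite ?mulf_neq0 ?sep1 ?sep2 ?sep3|]);
  apply: mx_specializesM;
  do ?[exact: (specializes_e_dot true)|exact: (specializes_e_dot false)].
Qed.

(** The dressings [d_j^u(x_i)] occur only for distinct sites, so genericity keeps every denominator
    nonzero at 0. *)
Lemma specializes_Gamma k : mx_specializes (Gamma qK xK k zK) (Gamma q x k z).
Proof.
have [->|->|->] := ord3P k.
- by apply: mx_specializes_prod => i _; apply: specializes_d.
- apply: mx_specializes_sum => u _; apply: mx_specializes_sum => i _.
  apply: mx_specializesM; first exact: specializes_e_dot.
  apply: mx_specializes_prod => j ne_ji; apply: mx_specializesM.
    exact: specializes_d.
  exact: specializes_d_dot.
apply: mx_specializesD.
  apply: mx_specializes_sum => i _; apply: mx_specializesM.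
    by apply: e_specializes; spec_arith; rewrite ?mulf_neq0 ?xz2 ?xz3.
  apply: mx_specializes_prod => j ne_ji; apply: mx_specializesM.
    exact: specializes_d.
  exact: specializes_d_bw.
apply: mx_specializes_sum => u _; apply: mx_specializes_sum => v _.
apply: mx_specializes_sum => i _; apply: mx_specializes_sum => j lt_ij.
have ne_ij : i != j by rewrite -val_eqE neq_ltn lt_ij.
apply: mx_specializesM; first exact: specializes_e_dot2.
apply: mx_specializes_prod => k' /andP[ne_ki ne_kj]; apply: mx_specializesM.
  apply: mx_specializesM; first exact: specializes_d.
  exact: specializes_d_dot.
exact: specializes_d_dot.
Qed.

End SpecializeOperators.

(** * Deformation of the spectral parameters and conclusion *)

Section Deformation.
Variables (F : fieldType) (N : nat) (q : F) (x : 'I_N -> F).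
Notation K := {fraction {poly F}}.

(** The exponents are positive, so the value at 0 is [x i], and distinct, so different sites are
    separated by their coefficients. *)
Definition shift_param (i : 'I_N) : {poly F} := (x i)%:P + 'X^(i.+1).

Lemma shift_param_spec i : specializes (tofrac (shift_param i)) (x i).
Proof.
have := specializes_poly (shift_param i).
by rewrite hornerD hornerC hornerXn expr0n addr0.
Qed.

Lemma shift_param_const i (c : F) : shift_param i - c%:P != 0.
Proof.
apply/eqP => /(congr1 (fun p : {poly F} => p`_i.+1)).
by rewrite !coefE eqxx subr0 add0r => /eqP; rewrite oner_eq0.
Qed.

(** The coefficient of degree [i.+1] is 1, whatever [c] is. *)
Lemma shift_param_sep i j (c : F) : i != j ->
  shift_param i - c%:P * shift_param j != 0.
Proof.
move=> ne_ij; apply/eqP => /(congr1 (fun p : {poly F} => p`_i.+1)).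
rewrite /= coefB coefCM !coefD !coefC !coefXn eqxx eqSS (inj_eq val_inj) (negbTE ne_ij).
by rewrite /= addr0 mulr0 subr0 add0r => /eqP; rewrite oner_eq0.
Qed.

Lemma shift_param_generic : q != 0 -> 1 - q != 0 -> 1 + q != 0 ->
  strongly_separated (tofrac q%:P : K) (fun i => tofrac (shift_param i)).
Proof.
move=> q0 q1 q2.
have nzC (c : F) : c != 0 -> tofrac c%:P != 0 :> K.
  by rewrite tofrac_eq0 polyC_eq0.
have nz i j c : i != j ->
    tofrac (shift_param i) - tofrac c%:P * tofrac (shift_param j) != 0 :> K.
  by move=> ne_ij; rewrite -tofracM -tofracB tofrac_eq0 shift_param_sep.
split=> [|i|i j ne_ij].
- split; rewrite -?tofrac1 -?tofracD -?tofracB -?polyC1 -?polyCD -?polyCB ?nzC //.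
  move=> i j ne_ij; split; last exact: nz.
  by have := nz i j 1 ne_ij; rewrite tofrac1 mul1r.
- by have := shift_param_const i 0; rewrite subr0 tofrac_eq0.
- by rewrite -!tofracXn -!polyC_exp; split; apply: nz.
Qed.

End Deformation.

Theorem theorem3p8p4 (F : fieldType) (N : nat) (N_ge1 : (1 <= N)%N)
    (q : F) (x : 'I_N -> F) (z : nat -> F) (qxz_generic : generic q x z)
    (S : nat -> 'I_3) (L L' : nat)
    (S_below_L : string_below S L) (S_below_L' : string_below S L')
    (S_size : (\sum_(c < L) S c)%N = (2 * N)%N) :
  F_S L q S x z =
  (bra_2N F N *m (\prod_(c < L') Gamma q x (S c) (z c)) *m ket_0N F N) 0 0.
Proof.
(* The product is padded to [L' + L] columns and then cut down to the [L] columns used in [F_S]. *)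
rewrite bra_ket_ent -(Gamma_prod_pad q x z L _ S_below_L') addnC Gamma_prod_pad //.
case: qxz_generic => -[q0 q1 q2] z0 xz sep.
pose qK : {fraction {poly F}} := tofrac q%:P.
pose xK i : {fraction {poly F}} := tofrac (shift_param x i).
pose zK c : {fraction {poly F}} := tofrac (z c)%:P.
have qs : specializes qK q by apply: specializes_const.
have xs i : specializes (xK i) (x i) by apply: shift_param_spec.
have zs c : specializes (zK c) (z c) by apply: specializes_const.
have sepK : strongly_separated qK xK by apply: shift_param_generic.
have admK c : admissible qK xK (zK c).
  split=> [|i]; first by rewrite tofrac_eq0 polyC_eq0.
  by split; rewrite -tofracXn -polyC_exp -tofracM -polyCM -tofracB tofrac_eq0
    shift_param_const.
have specF : specializes (F_S L qK S xK zK) (F_S L q S x z).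
  apply: specializes_sum => h _; apply: specializes_sum => v _.
  apply: specializes_prod => r _; apply: specializes_prod => c _.
  exact: specializes_ikW.
(* Both sides are values at 0 of one rational function, since the identity holds for the deformed
   parameters. *)
apply: specializes_uniq specF _.
rewrite (F_S_Gamma (@fraction_infinite F) sepK _ _ admK).
apply: mx_specializes_prod => c _.
exact: specializes_Gamma.
Qed.
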